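(* Let $G$ be a discrete group acting on a topological group $\Pi$, and let $\Gamma=\Pi\rtimes G$. The fixed point category $\mathcal{C}at(\tilde G,\Pi)^G$ is the disjoint union of the groups $\mathrm{Aut}\,\alpha$, where $\alpha$ runs over crossed homomorphisms representing the elements of $H^1(G;\Pi_G)$. Equivalently, $\mathcal{C}at(\tilde G,\Pi)^G$ is the disjoint union of the groups $\Pi\cap N_\Gamma\Lambda$, where $\Lambda$ runs over the $\Pi$-conjugacy classes of subgroups $\Lambda$ of $\Gamma$ such that $\Lambda\cap\Pi=e$. Therefore $B\,\mathcal{C}at(\tilde G,\Pi)^G$ is the disjoint union of the classifying spaces $B(\Pi\cap N_\Gamma\Lambda)$.
   Context: $G$ acts on $\Pi$ by group automorphisms, written $g\cdot\sigma$; $\Pi_G$ denotes $\Pi$ with this action. $\Gamma=\Pi\rtimes G$ is $\Pi\times G$ with product $(\sigma,g)(\tau,h)=(\sigma(g\cdot\tau),gh)$; $\Pi$ is identified with $\Pi\times e\subset\Gamma$, and $N_\Gamma\Lambda$ is the normalizer of $\Lambda$ in $\Gamma$. Subgroups are understood to be closed. $\tilde G$ is the category with object set $G$ and exactly one morphism between any two objects, with $G$ acting by left multiplication on objects (diagonally on morphisms). Groups are regarded as categories with one object; in particular $\Pi$ is regarded as the topological category with one object and morphism space $\Pi$, with its $G$-action. $\mathcal{C}at(\tilde G,\Pi)$ is the category of continuous functors $\tilde G\to\Pi$ and continuous natural transformations, with $G$ acting by conjugation: $(gF)(a)=g\cdot F(g^{-1}a)$, $(g\eta)_a=g\cdot\eta_{g^{-1}a}$.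 $B$ is the classifying space functor (geometric realization of the nerve). A crossed homomorphism is a continuous map $\alpha\colon G\to\Pi$ with $\alpha(gh)=\alpha(g)(g\cdot\alpha(h))$ for all $g,h\in G$. An isomorphism $\alpha\to\beta$ of crossed homomorphisms is an element $\sigma\in\Pi$ with $\beta(g)(g\cdot\sigma)=\sigma\alpha(g)$ for all $g\in G$; composition is multiplication in $\Pi$. Thus $\mathrm{Aut}\,\alpha=\{\sigma\in\Pi\mid\alpha(g)(g\cdot\sigma)=\sigma\alpha(g)\text{ for all }g\in G\}$. $H^1(G;\Pi_G)$ is the pointed set of isomorphism classes of crossed homomorphisms $G\to\Pi$, with basepoint the class of the trivial one.
   Formalization: The subgroups Λ are also required to project onto G (false otherwise: Π=1, G=Z/2), and the clauses on Λ assume e is closed in Π. ''Is the disjoint union'' is read as equivalence of categories (functors as a discrete object set) and homotopy equivalence of classifying spaces. *)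

(* Defs.v *)
From HB Require Import structures.
From mathcomp Require Import all_boot all_order all_algebra.
From mathcomp Require Import generic_quotient.
From mathcomp Require Import all_classical all_reals topology.
From Stdlib Require Import Relation_Operators Operators_Properties.

Set Implicit Arguments.
Unset Strict Implicit.
Unset Printing Implicit Defensive.

Import GRing.Theory Num.Theory numFieldTopology.Exports.

Local Obligation Tactic := idtac.

Local Open Scope classical_set_scope.
Local Open Scope quotient_scope.
Local Open Scope group_scope.

Lemma continuous_ptws (X : topologicalType) (I : Type) (T : topologicalType)
    (f : X -> {ptws I -> T}) :
  (forall i, continuous (fun x => f x i)) -> continuous f.
Proof.
move=> cf x; apply/cvg_sup => i.
exact: (@continuous_comp_initial _ _ _
  (fun h : I -> T => h i) (f : X -> initial_topology _) (cf i) x).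
Qed.

Lemma ptws_eval_continuous (I : Type) (T : topologicalType) (i : I) :
  continuous (fun h : {ptws I -> T} => h i).
Proof.
move=> h; have /cvg_sup/(_ i) hi : nbhs h --> h by exact: cvg_id.
move=> U hU; apply: hi.
exact: (@initial_continuous _ _ (fun k : I -> T => k i) h U hU).
Qed.

Lemma continuous_pair (X Y Z : topologicalType) (f : X -> Y) (g : X -> Z) :
  continuous f -> continuous g -> continuous (fun x => (f x, g x)).
Proof. by move=> cf cg x; apply: cvg_pair; [exact: cf|exact: cg]. Qed.

Lemma discrete_continuous (X : discreteTopologicalType) (Y : topologicalType)
  (f : X -> Y) : continuous f.
Proof. by apply/continuousP => A _; exact: discrete_open. Qed.

Lemma cts_comp (X Y Z : topologicalType) (f : X -> Y) (g : Y -> Z) :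
  continuous f -> continuous g -> continuous (fun x => g (f x)).
Proof. by move=> cf cg x; apply: continuous_comp; [exact: cf|exact: cg]. Qed.

Lemma cts_fst (X Y : topologicalType) : continuous (@fst X Y).
Proof. by move=> x; exact: cvg_fst. Qed.

Lemma cts_snd (X Y : topologicalType) : continuous (@snd X Y).
Proof. by move=> x; exact: cvg_snd. Qed.

HB.mixin Record Group_isTopGroup T of Group T & Topological T := {
  mulg_continuous : continuous (fun p : T * T => p.1 * p.2);
  invg_continuous : continuous (fun x : T => x^-1)
}.

#[short(type="topGroupType")]
HB.structure Definition TopGroup :=
  {T of Group T & Topological T & Group_isTopGroup T}.

#[short(type="discreteGroupType")]
HB.structure Definition DiscreteGroup := {T of TopGroup T & DiscreteTopology T}.

Record subgroup (P : groupType) := Subgroup {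
  sg_set : set P;
  sg1 : sg_set 1;
  sgM : forall x y, sg_set x -> sg_set y -> sg_set (x * y);
  sgV : forall x, sg_set x -> sg_set x^-1
}.

Definition subgroup_type (P : groupType) (H : subgroup P) : Type :=
  set_type (sg_set H).

Section SubgroupType.
Variables (P : topGroupType) (H : subgroup P).
Local Notation T := (subgroup_type H).

HB.instance Definition _ := Topological.copy T (set_type (sg_set H)).

Definition sgT_val (x : T) : P := set_val x.

Lemma sgT_valP (x : T) : sg_set H (sgT_val x).
Proof. exact: set_valP. Qed.

Definition sgT_one : T := exist _ 1 (mem_set (sg1 H)).
Definition sgT_mul (x y : T) : T :=
  exist _ (sgT_val x * sgT_val y) (mem_set (sgM (sgT_valP x) (sgT_valP y))).
Definition sgT_inv (x : T) : T :=
  exist _ (sgT_val x)^-1 (mem_set (sgV (sgT_valP x))).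

Lemma sgT_inj (x y : T) : sgT_val x = sgT_val y -> x = y.
Proof. exact: val_inj. Qed.

Lemma sgT_mulA : associative sgT_mul.
Proof. by move=> x y z; apply: sgT_inj; exact: mulgA. Qed.
Lemma sgT_mul1 : left_id sgT_one sgT_mul.
Proof. by move=> x; apply: sgT_inj; exact: mul1g. Qed.
Lemma sgT_1mul : right_id sgT_one sgT_mul.
Proof. by move=> x; apply: sgT_inj; exact: mulg1. Qed.
Lemma sgT_mulV : left_inverse sgT_one sgT_inv sgT_mul.
Proof. by move=> x; apply: sgT_inj; exact: mulVg. Qed.
Lemma sgT_Vmul : right_inverse sgT_one sgT_inv sgT_mul.
Proof. by move=> x; apply: sgT_inj; exact: mulgV. Qed.

HB.instance Definition _ :=
  isGroup.Build T sgT_mulA sgT_mul1 sgT_1mul sgT_mulV sgT_Vmul.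

Lemma sgT_val_continuous : continuous (sgT_val : T -> P).
Proof. exact: initial_continuous. Qed.

Lemma sgT_mul_continuous : continuous (fun p : T * T => p.1 * p.2).
Proof.
apply: continuous_comp_initial => -[x y].
apply: (@continuous_comp (T * T)%type (P * P)%type P
  (fun p => (sgT_val p.1, sgT_val p.2)) (fun p => p.1 * p.2)).
  apply: continuous_pair => z; apply: continuous_comp;
    by [exact: cvg_fst|exact: cvg_snd|exact: sgT_val_continuous].
exact: mulg_continuous.
Qed.

Lemma sgT_inv_continuous : continuous (fun x : T => x^-1).
Proof.
apply: continuous_comp_initial => x.
apply: (@continuous_comp T P P sgT_val (fun p => p^-1)).
  exact: sgT_val_continuous.
exact: invg_continuous.
Qed.

HB.instance Definition _ :=
  Group_isTopGroup.Build T sgT_mul_continuous sgT_inv_continuous.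

End SubgroupType.

Record groupAct (G Pi : topGroupType) := GroupAct {
  act :> G -> Pi -> Pi;
  act1g : forall x, act 1 x = x;
  actMg : forall g h x, act (g * h) x = act g (act h x);
  actg_mul : forall g x y, act g (x * y) = act g x * act g y;
  act_continuous : continuous (fun p : G * Pi => act p.1 p.2)
}.

Lemma actg1 (G Pi : topGroupType) (A : groupAct G Pi) g : A g 1 = 1.
Proof. by apply: (mulgI (A g 1)); rewrite -actg_mul !mulg1. Qed.

Lemma actgV (G Pi : topGroupType) (A : groupAct G Pi) g x : A g x^-1 = (A g x)^-1.
Proof. by apply: (mulgI (A g x)); rewrite -actg_mul !mulgV actg1. Qed.

Lemma act_continuousr (G Pi : topGroupType) (A : groupAct G Pi) g :
  continuous (A g).
Proof.
move=> x; apply: (@continuous_comp Pi (G * Pi)%type Pi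
  (fun x => (g, x)) (fun p => A p.1 p.2)); last exact: act_continuous.
by apply: continuous_pair => y; [exact: cvg_cst|exact: cvg_id].
Qed.

Definition sdprod (G Pi : topGroupType) (A : groupAct G Pi) : Type :=
  (Pi * G)%type.

Section SemidirectProduct.
Variables (G Pi : topGroupType) (A : groupAct G Pi).
Local Notation Gamma := (sdprod A).

HB.instance Definition _ := Topological.copy Gamma (Pi * G)%type.

Definition sd_one : Gamma := (1, 1).
Definition sd_mul (x y : Gamma) : Gamma := (x.1 * A x.2 y.1, x.2 * y.2).
Definition sd_inv (x : Gamma) : Gamma := (A x.2^-1 x.1^-1, x.2^-1).

Lemma sd_mulA : associative sd_mul.
Proof.
by move=> x y z; rewrite /sd_mul /= actg_mul actMg !mulgA.
Qed.
Lemma sd_mul1 : left_id sd_one sd_mul.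
Proof. by case=> x g; rewrite /sd_mul /= act1g !mul1g. Qed.
Lemma sd_1mul : right_id sd_one sd_mul.
Proof. by case=> x g; rewrite /sd_mul /= actg1 !mulg1. Qed.
Lemma sd_mulV : left_inverse sd_one sd_inv sd_mul.
Proof. by case=> x g; rewrite /sd_mul /= -actg_mul !mulVg actg1. Qed.
Lemma sd_Vmul : right_inverse sd_one sd_inv sd_mul.
Proof. by case=> x g; rewrite /sd_mul /= -actMg !mulgV act1g mulgV. Qed.

HB.instance Definition _ :=
  isGroup.Build Gamma sd_mulA sd_mul1 sd_1mul sd_mulV sd_Vmul.

Definition sd_inl (x : Pi) : Gamma := (x, 1).
Definition sd_proj (x : Gamma) : G := x.2.

End SemidirectProduct.

(* [comp g f] is meaningful only when [src g = tgt f]; its value is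
   unconstrained otherwise. *)

Record topCat := TopCat {
  ob : topologicalType;
  mor : topologicalType;
  src : mor -> ob;
  tgt : mor -> ob;
  idm : ob -> mor;
  comp : mor -> mor -> mor;
  src_idm : forall x, src (idm x) = x;
  tgt_idm : forall x, tgt (idm x) = x;
  src_comp : forall g f, src g = tgt f -> src (comp g f) = src f;
  tgt_comp : forall g f, src g = tgt f -> tgt (comp g f) = tgt g;
  comp1m : forall f, comp (idm (tgt f)) f = f;
  compm1 : forall f, comp f (idm (src f)) = f;
  compA : forall h g f, src h = tgt g -> src g = tgt f ->
    comp h (comp g f) = comp (comp h g) f;
  src_continuous : continuous src;
  tgt_continuous : continuous tgt;
  idm_continuous : continuous idm;
  comp_continuous :
    {within [set p : mor * mor | src p.1 = tgt p.2],
     continuous (fun p => comp p.1 p.2)}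
}.

Record functor (C D : topCat) := Functor {
  fob : ob C -> ob D;
  fmor : mor C -> mor D;
  fsrc : forall f, src (fmor f) = fob (src f);
  ftgt : forall f, tgt (fmor f) = fob (tgt f);
  fidm : forall x, fmor (idm x) = idm (fob x);
  fcomp : forall g f, src g = tgt f -> fmor (comp g f) = comp (fmor g) (fmor f);
  fob_continuous : continuous fob;
  fmor_continuous : continuous fmor
}.

Lemma functor_eq (C D : topCat) (F F' : functor C D) :
  fob F =1 fob F' -> fmor F =1 fmor F' -> F = F'.
Proof.
case: F F' => [fo fm a b c d e f] [fo' fm' a' b' c' d' e' f'] /= /funext E /funext E'.
move: E E' a' b' c' d' e' f' => <- <- *.
by congr Functor; exact: Prop_irrelevance.
Qed.

HB.instance Definition _ (C D : topCat) := gen_eqMixin (functor C D).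
HB.instance Definition _ (C D : topCat) := gen_choiceMixin (functor C D).

Section FunctorComposition.
Variables (C D E : topCat).

Program Definition functor_id : functor C C := {|
  fob := id; fmor := id
|}.
Next Obligation. by []. Qed.
Next Obligation. by []. Qed.
Next Obligation. by []. Qed.
Next Obligation. by []. Qed.
Next Obligation. by move=> x; exact: cvg_id. Qed.
Next Obligation. by move=> x; exact: cvg_id. Qed.

Program Definition functor_comp (K : functor D E) (F : functor C D) :
  functor C E := {|
  fob := fob K \o fob F;
  fmor := fmor K \o fmor F
|}.
Next Obligation. by move=> K F f /=; rewrite !fsrc. Qed.
Next Obligation. by move=> K F f /=; rewrite !ftgt. Qed.
Next Obligation. by move=> K F x /=; rewrite !fidm. Qed.
Next Obligation.
by move=> K F g f gf /=; rewrite !fcomp// fsrc ftgt gf.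
Qed.
Next Obligation.
by move=> K F x; apply: continuous_comp; exact: fob_continuous.
Qed.
Next Obligation.
by move=> K F x; apply: continuous_comp; exact: fmor_continuous.
Qed.
End FunctorComposition.

Record nattrans (C D : topCat) := NatTrans {
  nt_src : functor C D;
  nt_tgt : functor C D;
  nt_map : ob C -> mor D;
  nt_srcE : forall x, src (nt_map x) = fob nt_src x;
  nt_tgtE : forall x, tgt (nt_map x) = fob nt_tgt x;
  nt_natural : forall f, comp (nt_map (tgt f)) (fmor nt_src f)
                       = comp (fmor nt_tgt f) (nt_map (src f));
  nt_continuous : continuous nt_map
}.

Lemma nattrans_eq (C D : topCat) (a b : nattrans C D) :
  nt_src a = nt_src b -> nt_tgt a = nt_tgt b -> nt_map a =1 nt_map b -> a = b.
Proof.
case: a b => [F K m p q r s] [F' K' m' p' q' r' s'] /= E1 E2 /funext E3.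
move: E1 E2 E3 p' q' r' s' => <- <- <- *.
by congr NatTrans; exact: Prop_irrelevance.
Qed.

HB.instance Definition _ (C D : topCat) := gen_eqMixin (nattrans C D).
HB.instance Definition _ (C D : topCat) := gen_choiceMixin (nattrans C D).

Definition nat_iso (C D : topCat) (F F' : functor C D) : Prop :=
  exists a b : nattrans C D,
    [/\ nt_src a = F, nt_tgt a = F', nt_src b = F' & nt_tgt b = F] /\
    forall x, comp (nt_map b x) (nt_map a x) = idm (fob F x) /\
              comp (nt_map a x) (nt_map b x) = idm (fob F' x).

Definition cat_equivalent (C D : topCat) : Prop :=
  exists (F : functor C D) (K : functor D C),
    nat_iso (functor_comp K F) (functor_id C) /\
    nat_iso (functor_comp F K) (functor_id D).

(* For a group [X] this is $\tilde X$; the morphism [(a, b)] goes from [a] to [b]. *)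
Program Definition chaotic (X : topologicalType) : topCat := {|
  ob := X;
  mor := (X * X)%type;
  src := fst;
  tgt := snd;
  idm := fun x => (x, x);
  comp := fun g f => (f.1, g.2)
|}.
Next Obligation. by []. Qed.
Next Obligation. by []. Qed.
Next Obligation. by []. Qed.
Next Obligation. by []. Qed.
Next Obligation. by move=> X [] *. Qed.
Next Obligation. by move=> X [] *. Qed.
Next Obligation. by []. Qed.
Next Obligation. by move=> X x; exact: cvg_fst. Qed.
Next Obligation. by move=> X x; exact: cvg_snd. Qed.
Next Obligation. by move=> X; apply: continuous_pair => x; exact: cvg_id. Qed.
Next Obligation.
move=> X; apply: continuous_subspaceT; apply: continuous_pair => x;
  apply: continuous_comp; by [exact: cvg_fst|exact: cvg_snd].
Qed.

Program Definition group_cat (P : topGroupType) : topCat := {|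
  ob := discrete_topology unit;
  mor := P;
  src := fun=> tt;
  tgt := fun=> tt;
  idm := fun=> 1;
  comp := fun x y => x * y
|}.
Next Obligation. by move=> P []. Qed.
Next Obligation. by move=> P []. Qed.
Next Obligation. by []. Qed.
Next Obligation. by []. Qed.
Next Obligation. by move=> P x; exact: mul1g. Qed.
Next Obligation. by move=> P x; exact: mulg1. Qed.
Next Obligation. by move=> P *; exact: mulgA. Qed.
Next Obligation. by move=> P x; exact: cvg_cst. Qed.
Next Obligation. by move=> P x; exact: cvg_cst. Qed.
Next Obligation. by move=> P x; exact: cvg_cst. Qed.
Next Obligation.
by move=> P; apply: continuous_subspaceT; exact: mulg_continuous.
Qed.

(* The functors form a plain set of objects, given the discrete topology.  The
   natural transformations between two functors carry the topology of pointwise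
   convergence, which for discrete [ob C] is the compact-open topology. *)

Section FunctorCategory.
Variables (C D : topCat).
Local Notation objs := (discrete_topology (functor C D)).

Definition nt_data (a : nattrans C D) : objs * objs * {ptws ob C -> mor D} :=
  (nt_src a, nt_tgt a, nt_map a).

HB.instance Definition _ :=
  Topological.copy (nattrans C D) (initial_topology nt_data).

Lemma nt_data_continuous : continuous nt_data.
Proof. exact: initial_continuous. Qed.

Lemma nt_src_continuous : continuous (@nt_src C D : nattrans C D -> objs).
Proof.
move=> a; apply: (@continuous_comp _ _ _ nt_data (fun p => p.1.1)).
  exact: nt_data_continuous.
by apply: continuous_comp; exact: cvg_fst.
Qed.

Lemma nt_tgt_continuous : continuous (@nt_tgt C D : nattrans C D -> objs).
Proof.
move=> a; apply: (@continuous_comp _ _ _ nt_data (fun p => p.1.2)).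
  exact: nt_data_continuous.
by apply: continuous_comp; [exact: cvg_fst|exact: cvg_snd].
Qed.

Lemma nt_map_continuous x : continuous (fun a : nattrans C D => nt_map a x).
Proof.
move=> a; apply: (@continuous_comp _ _ _ nt_data (fun p => p.2 x)).
  exact: nt_data_continuous.
apply: (@continuous_comp _ _ _ snd (fun h : {ptws ob C -> mor D} => h x)).
  exact: cvg_snd.
exact: ptws_eval_continuous.
Qed.

Lemma nattrans_continuous (X : topologicalType) (u : X -> nattrans C D) :
  continuous (fun x => nt_src (u x) : objs) ->
  continuous (fun x => nt_tgt (u x) : objs) ->
  (forall c, continuous (fun x => nt_map (u x) c)) -> continuous u.
Proof.
move=> cs ct cm; apply: continuous_comp_initial.
apply: (@continuous_pair _ _ _ (fun x => (nt_src (u x) : objs, nt_tgt (u x) : objs))).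
  exact: continuous_pair.
exact: continuous_ptws.
Qed.

Program Definition nt_id (F : functor C D) : nattrans C D := {|
  nt_src := F; nt_tgt := F; nt_map := fun x => idm (fob F x)
|}.
Next Obligation. by move=> F x; rewrite /= src_idm. Qed.
Next Obligation. by move=> F x; rewrite /= tgt_idm. Qed.
Next Obligation. by move=> F f; rewrite /= -ftgt comp1m -fsrc compm1. Qed.
Next Obligation.
by move=> F x; apply: continuous_comp;
  [exact: fob_continuous|exact: idm_continuous].
Qed.

Lemma nt_composable (b a : nattrans C D) : nt_src b = nt_tgt a ->
  forall x, src (nt_map b x) = tgt (nt_map a x).
Proof. by move=> e x; rewrite nt_srcE nt_tgtE e. Qed.

Lemma comp_continuous2 (X : topologicalType) (u v : X -> mor D) :
  (forall x, src (u x) = tgt (v x)) -> continuous u -> continuous v ->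
  continuous (fun x => comp (u x) (v x)).
Proof.
move=> uv cu cv; pose S := [set p : mor D * mor D | src p.1 = tgt p.2].
have /subspace_sigL_continuousP cS := @comp_continuous D.
pose w (x : X) : set_type S := exist _ (u x, v x) (mem_set (uv x : S (u x, v x))).
move=> x; apply: (@continuous_comp _ (set_type S) _ w
  (sigL S (fun p : mor D * mor D => comp p.1 p.2))); last exact: cS.
by apply: continuous_comp_initial; apply: continuous_pair.
Qed.

(* Vertical composition, [theta] after [eta]. *)
Program Definition nt_vcomp (theta eta : nattrans C D)
    (e : nt_src theta = nt_tgt eta) : nattrans C D := {|
  nt_src := nt_src eta;
  nt_tgt := nt_tgt theta;
  nt_map := fun x => comp (nt_map theta x) (nt_map eta x)
|}.
Next Obligation.
by move=> b a e x; rewrite /= (src_comp (nt_composable e x)) nt_srcE.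
Qed.
Next Obligation.
by move=> b a e x; rewrite /= (tgt_comp (nt_composable e x)) nt_tgtE.
Qed.
Next Obligation.
move=> b a e f; have ba := nt_composable e.
have h1 : src (nt_map a (tgt f)) = tgt (fmor (nt_src a) f).
  by rewrite nt_srcE ftgt.
have h2 : src (nt_map b (tgt f)) = tgt (fmor (nt_tgt a) f).
  by rewrite nt_srcE e ftgt.
have h3 : src (fmor (nt_tgt a) f) = tgt (nt_map a (src f)).
  by rewrite fsrc nt_tgtE.
have h4 : src (fmor (nt_tgt b) f) = tgt (nt_map b (src f)).
  by rewrite fsrc nt_tgtE.
rewrite -(compA (ba _) h1) nt_natural (compA h2 h3) -e nt_natural.
by rewrite -(compA h4 (ba _)).
Qed.
Next Obligation.
move=> b a e; apply: comp_continuous2; [exact: nt_composable| |];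
  exact: nt_continuous.
Qed.

Definition nt_comp (theta eta : nattrans C D) : nattrans C D :=
  if pselect (nt_src theta = nt_tgt eta) is left e then nt_vcomp e else eta.

Lemma nt_compE (b a : nattrans C D) : nt_src b = nt_tgt a ->
  [/\ nt_src (nt_comp b a) = nt_src a, nt_tgt (nt_comp b a) = nt_tgt b &
      nt_map (nt_comp b a) = fun x => comp (nt_map b x) (nt_map a x)].
Proof. by move=> e; rewrite /nt_comp; case: pselect. Qed.

Program Definition functor_cat : topCat := {|
  ob := objs;
  mor := nattrans C D;
  src := @nt_src C D;
  tgt := @nt_tgt C D;
  idm := nt_id;
  comp := nt_comp
|}.
Next Obligation. by []. Qed.
Next Obligation. by []. Qed.
Next Obligation. by move=> g f /nt_compE[]. Qed.
Next Obligation. by move=> g f /nt_compE[]. Qed.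
Next Obligation.
move=> f; have [e1 e2 e3] := @nt_compE (nt_id (nt_tgt f)) f erefl.
by apply: nattrans_eq => // x; rewrite e3 /= -nt_tgtE comp1m.
Qed.
Next Obligation.
move=> f; have [e1 e2 e3] := @nt_compE f (nt_id (nt_src f)) erefl.
by apply: nattrans_eq => // x; rewrite e3 /= -nt_srcE compm1.
Qed.
Next Obligation.
move=> h g f hg gf.
have [gf1 gf2 gf3] := nt_compE gf.
have [hg1 hg2 hg3] := nt_compE hg.
have h1 : nt_src h = nt_tgt (nt_comp g f) by rewrite gf2.
have h2 : nt_src (nt_comp h g) = nt_tgt f by rewrite hg1.
have [a1 a2 a3] := nt_compE h1.
have [b1 b2 b3] := nt_compE h2.
apply: nattrans_eq.
- by rewrite a1 b1.
- by rewrite a2 b2.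
- by move=> x; rewrite a3 b3 gf3 hg3 (compA (nt_composable hg x) (nt_composable gf x)).
Qed.
Next Obligation. exact: nt_src_continuous. Qed.
Next Obligation. exact: nt_tgt_continuous. Qed.
Next Obligation. exact: (@discrete_continuous objs). Qed.
Next Obligation.
apply/subspace_sigL_continuousP.
set S := [set p : _ | _]; have SE (p : set_type S) : nt_src (val p).1 = nt_tgt (val p).2.
  exact: set_mem (valP p).
have cval : continuous (val : set_type S -> _) by exact: initial_continuous.
have c1 : continuous (fun p : set_type S => (val p).1).
  exact: (cts_comp cval (@cts_fst _ _)).
have c2 : continuous (fun p : set_type S => (val p).2).
  exact: (cts_comp cval (@cts_snd _ _)).
apply: nattrans_continuous => [||c].
- rewrite (_ : (fun=> _) = fun p : set_type S => nt_src (val p).2).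
    exact: (cts_comp c2 nt_src_continuous).
  by apply/funext => p; have [-> _ _] := nt_compE (SE p).
- rewrite (_ : (fun=> _) = fun p : set_type S => nt_tgt (val p).1).
    exact: (cts_comp c1 nt_tgt_continuous).
  by apply/funext => p; have [_ -> _] := nt_compE (SE p).
- rewrite (_ : (fun=> _) = fun p : set_type S =>
      comp (nt_map (val p).1 c) (nt_map (val p).2 c)).
    apply: comp_continuous2 => [p||].
    + exact: (nt_composable (SE p)).
    + exact: (cts_comp c1 (@nt_map_continuous c)).
    + exact: (cts_comp c2 (@nt_map_continuous c)).
  by apply/funext => p; have [_ _ E] := nt_compE (SE p); rewrite /= /sigL /= E.
Qed.
End FunctorCategory.

(* Joint continuity in [G] is not required: it is automatic for discrete [G]. *)

Record catAct (G : topGroupType) (C : topCat) := CatAct {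
  ca :> G -> functor C C;
  ca1 : ca 1 = functor_id C;
  caM : forall g h, ca (g * h) = functor_comp (ca g) (ca h)
}.

Section CatActTheory.
Variables (G : topGroupType) (C : topCat) (A : catAct G C).

Lemma ca_ob1 x : fob (A 1) x = x. Proof. by rewrite ca1. Qed.
Lemma ca_mor1 f : fmor (A 1) f = f. Proof. by rewrite ca1. Qed.
Lemma ca_obM g h x : fob (A (g * h)) x = fob (A g) (fob (A h) x).
Proof. by rewrite caM. Qed.
Lemma ca_morM g h f : fmor (A (g * h)) f = fmor (A g) (fmor (A h) f).
Proof. by rewrite caM. Qed.

End CatActTheory.

Section TranslationAction.
Variable G : topGroupType.

Lemma mulgl_continuous (g : G) : continuous (fun a : G => g * a).
Proof.
apply: (@cts_comp _ _ _ (fun a : G => (g, a)) _ _ (@mulg_continuous G)).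
by apply: continuous_pair => x; [exact: cvg_cst|exact: cvg_id].
Qed.

Program Definition translation (g : G) : functor (chaotic G) (chaotic G) := {|
  fob := (fun a => g * a) : ob (chaotic G) -> ob (chaotic G);
  fmor := (fun f => (g * f.1, g * f.2)) : mor (chaotic G) -> mor (chaotic G)
|}.
Next Obligation. by []. Qed.
Next Obligation. by []. Qed.
Next Obligation. by []. Qed.
Next Obligation. by []. Qed.
Next Obligation. exact: mulgl_continuous. Qed.
Next Obligation.
move=> g; apply: continuous_pair.
  exact: (cts_comp (@cts_fst _ _) (@mulgl_continuous g)).
exact: (cts_comp (@cts_snd _ _) (@mulgl_continuous g)).
Qed.

Program Definition translation_act : catAct G (chaotic G) := {|
  ca := translation
|}.
Next Obligation. by apply: functor_eq => [a|[a b]] /=; rewrite !mul1g. Qed.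
Next Obligation. by move=> g h; apply: functor_eq => [a|[a b]] /=; rewrite !mulgA. Qed.

End TranslationAction.

Section GroupCatAction.
Variables (G Pi : topGroupType) (A : groupAct G Pi).

Program Definition group_cat_map (g : G) :
    functor (group_cat Pi) (group_cat Pi) := {|
  fob := id;
  fmor := A g : mor (group_cat Pi) -> mor (group_cat Pi)
|}.
Next Obligation. by []. Qed.
Next Obligation. by []. Qed.
Next Obligation. by move=> g x; exact: actg1. Qed.
Next Obligation. by move=> g x y xy; exact: actg_mul. Qed.
Next Obligation. by move=> g x; exact: cvg_id. Qed.
Next Obligation. by move=> g; exact: act_continuousr. Qed.

Program Definition group_cat_act : catAct G (group_cat Pi) := {|
  ca := group_cat_map
|}.
Next Obligation. by apply: functor_eq => [[]|x] //; exact: act1g. Qed.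
Next Obligation. by move=> g h; apply: functor_eq => [[]|x] //; exact: actMg. Qed.

End GroupCatAction.

Section ConjugationAction.
Variables (G : topGroupType) (C D : topCat) (A : catAct G C) (B : catAct G D).

Definition conj_functor (g : G) (F : functor C D) : functor C D :=
  functor_comp (functor_comp (B g) F) (A g^-1).

Program Definition conj_nattrans (g : G) (eta : nattrans C D) : nattrans C D := {|
  nt_src := conj_functor g (nt_src eta);
  nt_tgt := conj_functor g (nt_tgt eta);
  nt_map := fun a => fmor (B g) (nt_map eta (fob (A g^-1) a))
|}.
Next Obligation. by move=> g eta x; rewrite fsrc nt_srcE. Qed.
Next Obligation. by move=> g eta x; rewrite ftgt nt_tgtE. Qed.
Next Obligation.
move=> g eta f /=; rewrite -!fcomp; last 2 first.
- by rewrite fsrc nt_tgtE fsrc.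
- by rewrite ftgt nt_srcE ftgt.
by rewrite -ftgt nt_natural fsrc.
Qed.
Next Obligation.
move=> g eta; apply: (cts_comp _ (@fmor_continuous _ _ (B g))).
exact: (cts_comp (@fob_continuous _ _ (A g^-1)) (@nt_continuous _ _ eta)).
Qed.

Lemma conj_functor1 F : conj_functor 1 F = F.
Proof. by apply: functor_eq => x /=; rewrite invg1 !ca1. Qed.

Lemma conj_functorM g h F :
  conj_functor (g * h) F = conj_functor g (conj_functor h F).
Proof. by apply: functor_eq => x /=; rewrite invgM !caM. Qed.

Program Definition conj_map (g : G) :
    functor (functor_cat C D) (functor_cat C D) := {|
  fob := conj_functor g : ob (functor_cat C D) -> ob (functor_cat C D);
  fmor := conj_nattrans g : mor (functor_cat C D) -> mor (functor_cat C D)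
|}.
Next Obligation. by []. Qed.
Next Obligation. by []. Qed.
Next Obligation.
by move=> g F; apply: nattrans_eq => // x /=; rewrite fidm.
Qed.
Next Obligation.
move=> g b a e; have [e1 e2 e3] := nt_compE e.
have e' : nt_src (conj_nattrans g b) = nt_tgt (conj_nattrans g a).
  by congr conj_functor.
have [f1 f2 f3] := nt_compE e'.
apply: nattrans_eq => [||x] /=.
- by rewrite e1 f1.
- by rewrite e2 f2.
- by rewrite e3 f3 /= fcomp//; exact: nt_composable.
Qed.
Next Obligation.
move=> g; exact: (@discrete_continuous (discrete_topology (functor C D))).
Qed.
Next Obligation.
move=> g; apply: nattrans_continuous => [||c].
- apply: (cts_comp (@nt_src_continuous C D)).
  exact: (@discrete_continuous (discrete_topology (functor C D))).
- apply: (cts_comp (@nt_tgt_continuous C D)).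
  exact: (@discrete_continuous (discrete_topology (functor C D))).
- exact: (cts_comp (@nt_map_continuous C D _) (@fmor_continuous _ _ (B g))).
Qed.

Program Definition conj_act : catAct G (functor_cat C D) := {| ca := conj_map |}.
Next Obligation.
apply: functor_eq => [F|eta] /=; first exact: conj_functor1.
apply: nattrans_eq => [||x] /=; try exact: conj_functor1.
by rewrite invg1 !ca1.
Qed.
Next Obligation.
move=> g h; apply: functor_eq => [F|eta] /=; first exact: conj_functorM.
apply: nattrans_eq => [||x] /=; try exact: conj_functorM.
by rewrite invgM !caM.
Qed.

End ConjugationAction.

Section FixedCategory.
Variables (G : topGroupType) (C : topCat) (A : catAct G C).

Definition fixed_ob : set (ob C) := [set x | forall g, fob (A g) x = x].
Definition fixed_mor : set (mor C) := [set f | forall g, fmor (A g) f = f].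

Lemma fixed_src (f : set_type fixed_mor) : src (val f) \in fixed_ob.
Proof. by apply/mem_set => g; rewrite -fsrc (set_mem (valP f)). Qed.

Lemma fixed_tgt (f : set_type fixed_mor) : tgt (val f) \in fixed_ob.
Proof. by apply/mem_set => g; rewrite -ftgt (set_mem (valP f)). Qed.

Lemma fixed_idm (x : set_type fixed_ob) : idm (val x) \in fixed_mor.
Proof. by apply/mem_set => g; rewrite fidm (set_mem (valP x)). Qed.

Lemma fixed_comp (g f : set_type fixed_mor) : src (val g) = tgt (val f) ->
  comp (val g) (val f) \in fixed_mor.
Proof.
by move=> e; apply/mem_set => a; rewrite fcomp// (set_mem (valP g)) (set_mem (valP f)).
Qed.

Definition fixed_compose (g f : set_type fixed_mor) : set_type fixed_mor :=
  insubd f (comp (val g) (val f)).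

Lemma val_fixed_compose (g f : set_type fixed_mor) : src (val g) = tgt (val f) ->
  val (fixed_compose g f) = comp (val g) (val f).
Proof. by move=> e; rewrite val_insubd fixed_comp. Qed.

Program Definition fixed_cat : topCat := {|
  ob := set_type fixed_ob;
  mor := set_type fixed_mor;
  src := fun f => exist _ (src (val f)) (fixed_src f);
  tgt := fun f => exist _ (tgt (val f)) (fixed_tgt f);
  idm := fun x => exist _ (idm (val x)) (fixed_idm x);
  comp := fixed_compose
|}.
Next Obligation. by move=> x; apply: val_inj; rewrite /= src_idm. Qed.
Next Obligation. by move=> x; apply: val_inj; rewrite /= tgt_idm. Qed.
Next Obligation.
move=> g f /(congr1 val)/= e; apply: val_inj => /=.
by rewrite val_fixed_compose// src_comp.
Qed.
Next Obligation.
move=> g f /(congr1 val)/= e; apply: val_inj => /=.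
by rewrite val_fixed_compose// tgt_comp.
Qed.
Next Obligation.
move=> f; apply: val_inj; rewrite val_fixed_compose /= ?src_idm//.
exact: comp1m.
Qed.
Next Obligation.
move=> f; apply: val_inj; rewrite val_fixed_compose /= ?tgt_idm//.
exact: compm1.
Qed.
Next Obligation.
move=> h g f /(congr1 val)/= hg /(congr1 val)/= gf; apply: val_inj.
have h1 : src (val h) = tgt (val (fixed_compose g f)).
  by rewrite val_fixed_compose// tgt_comp.
have h2 : src (val (fixed_compose h g)) = tgt (val f).
  by rewrite val_fixed_compose// src_comp.
rewrite (val_fixed_compose h1) (val_fixed_compose h2).
by rewrite (val_fixed_compose gf) (val_fixed_compose hg) compA.
Qed.
Next Obligation.
apply: continuous_comp_initial.
exact: (cts_comp (@initial_continuous _ _ _) (@src_continuous C)).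
Qed.
Next Obligation.
apply: continuous_comp_initial.
exact: (cts_comp (@initial_continuous _ _ _) (@tgt_continuous C)).
Qed.
Next Obligation.
apply: continuous_comp_initial.
exact: (cts_comp (@initial_continuous _ _ _) (@idm_continuous C)).
Qed.
Next Obligation.
apply/subspace_sigL_continuousP; apply: continuous_comp_initial.
set S := [set p : _ | _].
have SE (p : set_type S) : src (val (val p).1) = tgt (val (val p).2).
  exact: (congr1 val (set_mem (valP p))).
have cval : continuous (val : set_type S -> _) by exact: initial_continuous.
rewrite (_ : _ \o _ = fun p : set_type S => comp (val (val p).1) (val (val p).2)).
  apply: comp_continuous2 => //.
    apply: (cts_comp (cts_comp cval (@cts_fst _ _))); exact: initial_continuous.
  apply: (cts_comp (cts_comp cval (@cts_snd _ _))); exact: initial_continuous.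
by apply/funext => p; exact: (val_fixed_compose (SE p)).
Qed.

End FixedCategory.

Section SumCategory.
Variables (I : choiceType) (C : I -> topCat).

Lemma sum_cat_continuous (X : I -> topologicalType) (Y : I -> topologicalType)
    (f : forall i, X i -> Y i) : (forall i, continuous (f i)) ->
  continuous (fun x : {i & X i} => existT Y (tag x) (f (tag x) (tagged x))).
Proof.
move=> cf [i x] U nU.
exact: (cts_comp (cf i) (@existT_continuous _ _ i) nU).
Qed.

(* [tagged_as f g] is [tagged g] cast along [tag g = tag f]. *)
Program Definition sum_cat : topCat := {|
  ob := {i & ob (C i)};
  mor := {i & mor (C i)};
  src := fun f => existT _ (tag f) (src (tagged f));
  tgt := fun f => existT _ (tag f) (tgt (tagged f));
  idm := fun x => existT _ (tag x) (idm (tagged x));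
  comp := fun g f => existT _ (tag f) (comp (tagged_as f g) (tagged f))
|}.
Next Obligation. by move=> [i x]; rewrite /= src_idm. Qed.
Next Obligation. by move=> [i x]; rewrite /= tgt_idm. Qed.
Next Obligation.
move=> [i g] [j f] /= e; have ij := congr1 (@projT1 _ _) e; rewrite /= in ij.
case: _ / ij f e => f e; rewrite tagged_asE src_comp//.
exact: existT_inj2 e.
Qed.
Next Obligation.
move=> [i g] [j f] /= e; have ij := congr1 (@projT1 _ _) e; rewrite /= in ij.
case: _ / ij f e => f e; rewrite tagged_asE tgt_comp//.
exact: existT_inj2 e.
Qed.
Next Obligation. by move=> [i f]; rewrite /= tagged_asE comp1m. Qed.
Next Obligation. by move=> [i f]; rewrite /= tagged_asE compm1. Qed.
Next Obligation.
move=> [i h] [j g] [k f] /= e e'.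
have ij := congr1 (@projT1 _ _) e; rewrite /= in ij.
case: _ / ij g e e' => g e e'.
have ik := congr1 (@projT1 _ _) e'; rewrite /= in ik.
case: _ / ik f e' => f e'.
by rewrite !tagged_asE (compA (existT_inj2 e) (existT_inj2 e')).
Qed.
Next Obligation. exact: (sum_cat_continuous (fun i => @src_continuous (C i))). Qed.
Next Obligation. exact: (sum_cat_continuous (fun i => @tgt_continuous (C i))). Qed.
Next Obligation. exact: (sum_cat_continuous (fun i => @idm_continuous (C i))). Qed.
Next Obligation.
apply/subspace_continuousP => -[[i g] [j f]] /= e.
have ij := congr1 (@projT1 _ _) e; rewrite /= in ij.
case: _ / ij f e => f e W; rewrite /from_subspace /= tagged_asE => nW.
have gf := existT_inj2 e.
have /subspace_continuousP/(_ (g, f) gf) := @comp_continuous (C i).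
move=> /(_ _ nW) [[P Q] /= [nP nQ] PQ].
exists (existT _ i @` P, existT _ i @` Q) => /=.
  by split; exact: existT_nbhs.
move=> [_ _] /= [[g' Pg' <-] [f' Qf' <-]] /= e'; rewrite tagged_asE.
exact: (PQ (g', f') (conj Pg' Qf') (existT_inj2 e')).
Qed.

End SumCategory.

Record ordmap (m n : nat) := OrdMap {
  om_fun :> 'I_m.+1 -> 'I_n.+1;
  om_homo : {homo om_fun : i j / (i <= j)%N}
}.

Definition ordmap_id n : ordmap n n := @OrdMap n n id (fun _ _ => id).

Definition ordmap_comp l m n (theta : ordmap m n) (phi : ordmap l m) :
  ordmap l n :=
  @OrdMap l n (theta \o phi)
    (fun i j ij => om_homo theta (om_homo phi ij)).

Record simplicialSpace := SimplicialSpace {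
  ssp : nat -> topologicalType;
  sop : forall m n, ordmap m n -> ssp n -> ssp m;
  sop_id : forall n x, sop (ordmap_id n) x = x;
  sop_comp : forall l m n (theta : ordmap m n) (phi : ordmap l m) x,
    sop (ordmap_comp theta phi) x = sop phi (sop theta x);
  sop_continuous : forall m n (theta : ordmap m n), continuous (sop theta)
}.

Section Realization.
Variable R : realType.

Definition std_simplex (n : nat) : set {ptws 'I_n.+1 -> R} :=
  [set t | (forall i, (0 <= t i)%R) /\ (\sum_i t i = 1)%R].
Arguments std_simplex : clear implicits.

Lemma simplex_map_subproof m n (theta : ordmap m n)
    (t : set_type (std_simplex m)) :
  (fun j => \sum_(i | theta i == j) val t i)%R \in std_simplex n.
Proof.
have [t0 t1] := set_mem (valP t); apply/mem_set; split => [j|].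
  by apply: sumr_ge0 => i _; exact: t0.
by rewrite -[RHS]t1 [RHS](partition_big theta predT).
Qed.

Definition simplex_map m n (theta : ordmap m n) (t : set_type (std_simplex m)) :
  set_type (std_simplex n) :=
  exist _ (fun j => \sum_(i | theta i == j) val t i)%R
    (simplex_map_subproof theta t).

Variable X : simplicialSpace.

Definition cells : Type := {n & (ssp X n * set_type (std_simplex n))%type}.

HB.instance Definition _ := Topological.copy cells {n & (ssp X n * set_type (std_simplex n))%type}.

Inductive glue : cells -> cells -> Prop :=
  Glue m n (theta : ordmap m n) (x : ssp X n) (t : set_type (std_simplex m)) :
    glue (existT _ m (sop theta x, t)) (existT _ n (x, simplex_map theta t)).

Definition glued (a b : cells) : bool := `[< clos_refl_sym_trans cells glue a b >].

Lemma glued_refl : reflexive glued.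
Proof. by move=> a; apply/asboolP; exact: rst_refl. Qed.
Lemma glued_sym : symmetric glued.
Proof. by move=> a b; apply/asboolP/asboolP => ?; exact: rst_sym. Qed.
Lemma glued_trans : transitive glued.
Proof.
by move=> b a c /asboolP ab /asboolP bc; apply/asboolP; exact: rst_trans bc.
Qed.

Canonical glued_equiv := EquivRel glued glued_refl glued_sym glued_trans.

Definition realization : topologicalType :=
  quotient_topology {eq_quot glued_equiv}.

End Realization.

Section Nerve.

Definition ord_arrow (n : nat) : Type := {p : 'I_n.+1 * 'I_n.+1 | (p.1 <= p.2)%N}.

HB.instance Definition _ n := Choice.on (ord_arrow n).
HB.instance Definition _ n := SubType.on (ord_arrow n).

Definition ord_comp n (g f : ord_arrow n) : ord_arrow n :=
  insubd f ((val f).1, (val g).2).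

Lemma val_ord_comp n (g f : ord_arrow n) : (val g).1 = (val f).2 ->
  val (ord_comp g f) = ((val f).1, (val g).2).
Proof.
move=> e; rewrite val_insubd /=; case: ifP => // /negP[].
by apply: leq_trans (valP f) _; rewrite -e; exact: (valP g).
Qed.

(* The ordered set $[n] = \{0 < \dots < n\}$ as a category. *)
Program Definition ord_cat (n : nat) : topCat := {|
  ob := discrete_topology 'I_n.+1;
  mor := discrete_topology (ord_arrow n);
  src := fun f : ord_arrow n => (val f).1;
  tgt := fun f : ord_arrow n => (val f).2;
  idm := fun i => exist _ (i, i) (leqnn i);
  comp := @ord_comp n
|}.
Next Obligation. by []. Qed.
Next Obligation. by []. Qed.
Next Obligation. by move=> n g f e /=; rewrite (val_ord_comp e). Qed.
Next Obligation. by move=> n g f e /=; rewrite (val_ord_comp e). Qed.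
Next Obligation.
by move=> n f; apply: val_inj; rewrite val_ord_comp//=; case: (val f).
Qed.
Next Obligation.
by move=> n f; apply: val_inj; rewrite val_ord_comp//=; case: (val f).
Qed.
Next Obligation.
move=> n h g f hg gf; apply: val_inj.
have h1 : (val h).1 = (val (ord_comp g f)).2 by rewrite (val_ord_comp gf).
have h2 : (val (ord_comp h g)).1 = (val f).2 by rewrite (val_ord_comp hg).
by rewrite (val_ord_comp h1) (val_ord_comp h2) (val_ord_comp gf) (val_ord_comp hg).
Qed.
Next Obligation. by move=> n; exact: (@discrete_continuous (discrete_topology _)). Qed.
Next Obligation. by move=> n; exact: (@discrete_continuous (discrete_topology _)). Qed.
Next Obligation. by move=> n; exact: (@discrete_continuous (discrete_topology _)). Qed.
Next Obligation.
move=> n; apply: continuous_subspaceT => -[g f] U /nbhs_singleton nU.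
exists ([set g], [set f]) => /=; first by split; exact: discrete_set1.
by move=> [_ _] /= [-> ->].
Qed.

Program Definition ord_functor m n (theta : ordmap m n) :
    functor (ord_cat m) (ord_cat n) := {|
  fob := theta : ob (ord_cat m) -> ob (ord_cat n);
  fmor := fun f : ord_arrow m =>
    exist _ (theta (val f).1, theta (val f).2) (om_homo theta (valP f))
|}.
Next Obligation. by []. Qed.
Next Obligation. by []. Qed.
Next Obligation. by move=> m n theta i; exact: val_inj. Qed.
Next Obligation.
move=> m n theta g f; rewrite [src g]/= [tgt f]/= => e; apply: val_inj.
rewrite [RHS]val_ord_comp; last by rewrite /= e.
by rewrite /= (val_ord_comp e).
Qed.
Next Obligation. by move=> *; exact: (@discrete_continuous (discrete_topology _)). Qed.
Next Obligation. by move=> *; exact: (@discrete_continuous (discrete_topology _)). Qed.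

Variable C : topCat.

(* [simplex n] is the space of functors $[n] \to C$, that is of strings of $n$
   composable morphisms, in the topology inherited from the morphism space. *)
Definition simplex (n : nat) : Type := functor (ord_cat n) C.

HB.instance Definition _ n := Choice.on (simplex n).

Definition simplex_data n (x : simplex n) :
    {ptws 'I_n.+1 -> ob C} * {ptws ord_arrow n -> mor C} := (fob x, fmor x).

HB.instance Definition _ n :=
  Topological.copy (simplex n) (initial_topology (@simplex_data n)).

Lemma simplex_ob_continuous n i : continuous (fun x : simplex n => fob x i).
Proof.
pose p := fun h : {ptws 'I_n.+1 -> ob C} * {ptws ord_arrow n -> mor C} => h.1 i.
apply: (@cts_comp _ _ _ (@simplex_data n) p); first exact: initial_continuous.
exact: (cts_comp (@cts_fst _ _) (@ptws_eval_continuous _ _ i)).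
Qed.

Lemma simplex_mor_continuous n f : continuous (fun x : simplex n => fmor x f).
Proof.
pose p := fun h : {ptws 'I_n.+1 -> ob C} * {ptws ord_arrow n -> mor C} => h.2 f.
apply: (@cts_comp _ _ _ (@simplex_data n) p); first exact: initial_continuous.
exact: (cts_comp (@cts_snd _ _) (@ptws_eval_continuous _ _ f)).
Qed.

Program Definition nerve : simplicialSpace := {|
  ssp := fun n => simplex n : topologicalType;
  sop := fun m n theta x => functor_comp x (ord_functor theta)
|}.
Next Obligation.
move=> n x; apply: functor_eq => //= f; congr (fmor x).
by apply: val_inj => /=; case: (val f).
Qed.
Next Obligation.
move=> l m n theta phi x; apply: functor_eq => //= f; congr (fmor x).
exact: val_inj.
Qed.
Next Obligation.
move=> m n theta; apply: continuous_comp_initial; apply: continuous_pair.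
  by apply: continuous_ptws => i; exact: simplex_ob_continuous.
by apply: continuous_ptws => f; exact: simplex_mor_continuous.
Qed.

End Nerve.

Definition B (R : realType) (C : topCat) : topologicalType :=
  realization R (nerve C).

Definition homotopic (R : realType) (X Y : topologicalType) (f g : X -> Y) : Prop :=
  exists H : X * R -> Y,
    [/\ {within [set p : X * R | (0 <= p.2 <= 1)%R], continuous H},
        (forall x, H (x, 0%R) = f x) & (forall x, H (x, 1%R) = g x)].

Definition homotopy_equivalent (R : realType) (X Y : topologicalType) : Prop :=
  exists (f : X -> Y) (g : Y -> X),
    [/\ continuous f, continuous g,
        homotopic R (g \o f) id & homotopic R (f \o g) id].

Section CrossedHom.
Variables (G Pi : topGroupType) (A : groupAct G Pi).

Record crossedHom := CrossedHom {
  ch :> G -> Pi;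
  chM : forall g h, ch (g * h) = ch g * A g (ch h);
  ch_continuous : continuous ch
}.

HB.instance Definition _ := gen_eqMixin crossedHom.
HB.instance Definition _ := gen_choiceMixin crossedHom.

Definition crossed_iso_by (alpha beta : crossedHom) : set Pi :=
  [set sigma | forall g, beta g * A g sigma = sigma * alpha g].

Definition crossed_iso (alpha beta : crossedHom) : bool :=
  `[< exists sigma, crossed_iso_by alpha beta sigma >].

Lemma crossed_iso_by1 alpha : crossed_iso_by alpha alpha 1.
Proof. by move=> g; rewrite actg1 mulg1 mul1g. Qed.

Lemma crossed_iso_byM alpha beta gamma sigma tau :
  crossed_iso_by beta gamma sigma -> crossed_iso_by alpha beta tau ->
  crossed_iso_by alpha gamma (sigma * tau).
Proof. by move=> s t g; rewrite actg_mul mulgA s -!mulgA t. Qed.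

Lemma crossed_iso_byV alpha beta sigma :
  crossed_iso_by alpha beta sigma -> crossed_iso_by beta alpha sigma^-1.
Proof.
move=> s g; apply: (mulgI sigma); rewrite mulgA -s -mulgA actgV mulgV mulg1.
by rewrite mulgA mulgV mul1g.
Qed.

Lemma crossed_iso_refl : reflexive crossed_iso.
Proof. by move=> a; apply/asboolP; exists 1; exact: crossed_iso_by1. Qed.
Lemma crossed_iso_sym : symmetric crossed_iso.
Proof.
by move=> a b; apply/asboolP/asboolP => -[s /crossed_iso_byV ?]; exists s^-1.
Qed.
Lemma crossed_iso_trans : transitive crossed_iso.
Proof.
move=> b a c /asboolP[s ab] /asboolP[t bc]; apply/asboolP; exists (t * s).
exact: crossed_iso_byM bc ab.
Qed.

Canonical crossed_iso_equiv :=
  EquivRel crossed_iso crossed_iso_refl crossed_iso_sym crossed_iso_trans.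

Definition H1 : choiceType := {eq_quot crossed_iso_equiv}.

Definition crossed_class (alpha : crossedHom) : H1 := \pi alpha.

Definition Aut (alpha : crossedHom) : subgroup Pi := {|
  sg_set := crossed_iso_by alpha alpha;
  sg1 := crossed_iso_by1 alpha;
  sgM := @crossed_iso_byM alpha alpha alpha;
  sgV := @crossed_iso_byV alpha alpha
|}.

End CrossedHom.

Section Normalizer.
Variable P : groupType.

Definition conj_set (x : P) (L : set P) : set P := [set x * y * x^-1 | y in L].

Lemma conj_set1 L : conj_set 1 L = L.
Proof.
rewrite /conj_set; under eq_imagel do rewrite invg1 mulg1 mul1g.
exact: image_id.
Qed.

Lemma conj_setM x y L : conj_set (x * y) L = conj_set x (conj_set y L).
Proof.
rewrite /conj_set image_comp; apply: eq_imagel => z _ /=.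
by rewrite invgM !mulgA.
Qed.

Definition normalizes (L : set P) : set P := [set x | conj_set x L = L].

Lemma normalizes1 L : normalizes L 1.
Proof. exact: conj_set1. Qed.

Lemma normalizesM L x y :
  normalizes L x -> normalizes L y -> normalizes L (x * y).
Proof. by move=> Lx Ly; rewrite /normalizes/= conj_setM Ly Lx. Qed.

Lemma normalizesV L x : normalizes L x -> normalizes L x^-1.
Proof.
by move=> Lx; rewrite /normalizes/= -[in LHS]Lx -conj_setM mulVg conj_set1.
Qed.

Definition normalizer (L : subgroup P) : subgroup P := {|
  sg_set := normalizes (sg_set L);
  sg1 := normalizes1 (sg_set L);
  sgM := @normalizesM (sg_set L);
  sgV := @normalizesV (sg_set L)
|}.

End Normalizer.

Section Complements.
Variables (G Pi : topGroupType) (A : groupAct G Pi).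
Local Notation Gamma := (sdprod A).

Lemma sd_inlM (x y : Pi) : sd_inl A (x * y) = sd_inl A x * sd_inl A y.
Proof.
rewrite [RHS](_ : _ = sd_mul (sd_inl A x) (sd_inl A y))//.
by rewrite /sd_mul /= act1g mulg1.
Qed.

Lemma sd_inlV (x : Pi) : sd_inl A x^-1 = (sd_inl A x)^-1.
Proof.
rewrite [RHS](_ : _ = sd_inv (sd_inl A x))//.
by rewrite /sd_inv /= invg1 act1g.
Qed.

(* $\Pi \cap H$, for $H \subset \Gamma$. *)
Program Definition capPi (H : subgroup Gamma) : subgroup Pi := {|
  sg_set := sd_inl A @^-1` sg_set H
|}.
Next Obligation. by move=> H; exact: sg1. Qed.
Next Obligation. by move=> H x y Hx Hy; rewrite /= sd_inlM; exact: sgM. Qed.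
Next Obligation. by move=> H x Hx; rewrite /= sd_inlV; exact: sgV. Qed.

(* A subgroup meeting $\Pi$ trivially contributes to the fixed points of all of
   $G$ only if it projects onto $G$; [cp_onto] records this. *)
Record complement := Complement {
  cp :> subgroup Gamma;
  cp_closed : closed (sg_set cp);
  cp_trivial : sg_set (capPi cp) = [set 1];
  cp_onto : sd_proj (A := A) @` sg_set cp = [set: G]
}.

HB.instance Definition _ := gen_eqMixin complement.
HB.instance Definition _ := gen_choiceMixin complement.

Definition Pi_conj (L M : complement) : bool :=
  `[< exists sigma : Pi, conj_set (sd_inl A sigma) (sg_set L) = sg_set M >].

Lemma Pi_conj_refl : reflexive Pi_conj.
Proof. by move=> L; apply/asboolP; exists 1; exact: conj_set1. Qed.
Lemma Pi_conj_sym : symmetric Pi_conj.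
Proof.
by move=> L M; apply/asboolP/asboolP => -[s <-]; exists s^-1;
  rewrite -conj_setM -sd_inlM mulVg; exact: conj_set1.
Qed.
Lemma Pi_conj_trans : transitive Pi_conj.
Proof.
move=> M L N /asboolP[s LM] /asboolP[t MN]; apply/asboolP; exists (t * s).
by rewrite sd_inlM conj_setM LM.
Qed.

Canonical Pi_conj_equiv :=
  EquivRel Pi_conj Pi_conj_refl Pi_conj_sym Pi_conj_trans.

Definition conj_classes : choiceType := {eq_quot Pi_conj_equiv}.

Definition conj_class (L : complement) : conj_classes := \pi L.

End Complements.

Definition fixed_point_category (G Pi : topGroupType) (A : groupAct G Pi) : topCat :=
  fixed_cat (conj_act (translation_act G) (group_cat_act A)).

(* Main.v *)
From Pilot Require Import Defs.
From HB Require Import structures.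
From mathcomp Require Import all_boot all_order all_algebra.
From mathcomp Require Import generic_quotient.
From mathcomp Require Import all_classical all_reals topology normedtype.
From mathcomp Require Import lra.
From Stdlib Require Import Relation_Operators.
(* Below, [comp] is the composition of a topological category. *)
Import Pilot.Defs.

(** A functor F from the chaotic category on G to Pi is determined by its values
    on the morphisms into 1, since F (a, b) = F (b, 1)^-1 F (a, 1).  If F is fixed
    by G, functoriality of F turns into the crossed homomorphism identity for
    alpha g = F (g, 1), and every crossed homomorphism arises in this way.
    Likewise a fixed natural transformation is determined by its component sigma
    at 1, the component at g being g . sigma, and its naturality is the equation
    saying that sigma is an isomorphism of crossed homomorphisms.  Thus the fixed
    point category is a groupoid with discrete objects whose morphism spaces are
    the sets [crossed_iso_by alpha beta], with the topology induced from Pi.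

    The disjoint union of the groups [Aut (r i)], for representatives r of the
    isomorphism classes, admits the same description: if r i and r j are isomorphic
    then i = j.  This common description is the record [crossedModel], and
    [model_equivalent] shows that two models with the same isomorphism classes are
    equivalent as topological categories: an isomorphism to a representative is
    chosen for each object, and since the objects are discrete these choices are
    continuous.  This gives [fixed_cat_sum].

    For the statement about subgroups of Gamma, a complement of Pi is the graph of
    a crossed homomorphism ([complement_graph], [graph_complement]), and conjugating
    by sigma in Pi carries the graph of alpha to the graph of beta exactly when
    sigma is an isomorphism from alpha to beta ([conj_graphP]).  Hence Pi-conjugacy
    classes correspond to H^1, and Pi meets the normalizer of the graph of alpha in
    Aut alpha.

    For classifying spaces, all the categories in sight are topological groupoids.
    A natural transformation eta from F to F' between functors into a groupoid
    induces a homotopy given by a single formula: the simplex x with vertices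
    x_0, ..., x_n and barycentric coordinates t is moved at time s inside the
    (2n+1)-simplex

      F x_0 -> ... -> F x_n -> F' x_0 -> ... -> F' x_n,

    where it has coordinates ((1 - s) t, s t).  The middle arrow exists because
    morphisms of a groupoid can be inverted.  The formula is compatible with faces
    and degeneracies ([prism_map], [join_weight_map]), and it is continuous on the
    realization because the product of a quotient map with the real line is again a
    quotient map ([continuous_quotient_cylinder]).  So an equivalence of topological
    groupoids gives a homotopy equivalence of classifying spaces
    ([cat_equivalent_homotopy_equivalent]).  Finally the classifying space of a
    disjoint union is homeomorphic to the disjoint union of the classifying spaces
    ([B_mergeK], [B_splitK]), because the vertices of a simplex all lie in the
    same summand. *)

Set Implicit Arguments.
Unset Strict Implicit.
Unset Printing Implicit Defensive.

Local Open Scope classical_set_scope.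
Local Open Scope quotient_scope.

(** * Continuity into and out of disjoint unions *)

Local Open Scope group_scope.

Lemma subspace_discrete_continuous (X : discreteTopologicalType) (S : set X)
    (T : topologicalType) (u : set_type S -> T) : continuous u.
Proof.
move=> x U /nbhs_singleton Ux; exists (val @^-1` [set val x]); split => //=.
  by exists [set val x] => //; exact: discrete_open.
by move=> y e; have -> : y = x by exact: val_inj.
Qed.

Lemma sigT_discrete_continuous (I : choiceType) (X : I -> topologicalType)
    (T : topologicalType) (u : {i & X i} -> T) :
  (forall i, continuous (fun x : X i => u (existT _ i x))) -> continuous u.
Proof. by move=> cu [i x] U nU; exact: (cu i x U nU). Qed.

(** All the summands lie in the same group P, so continuity can be tested after
    forgetting the summand, without transporting along equalities of indices. *)
Lemma continuous_sum_subgroup (X : topologicalType) (I : choiceType)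
    (P : topGroupType) (H : I -> subgroup P)
    (u : X -> {i & subgroup_type (H i)}) :
  continuous (fun x => tag (u x) : discrete_topology I) ->
  continuous (fun x => sgT_val (tagged (u x))) -> continuous u.
Proof.
move=> ct cv x U; case E : (u x) => [i s] /= [V [[O oO <-] /= Os OU]].
have nt : \forall y \near x, tag (u y) = i.
  have := ct x [set i]; rewrite /= E /=; apply.
  by apply: open_nbhs_nbhs; split => //; exact: (@discrete_open (discrete_topology I)).
have nv : \forall y \near x, O (sgT_val (tagged (u y))).
  by have := cv x O; rewrite /= E /=; apply; exact: open_nbhs_nbhs.
change (\forall y \near x, U (u y)); apply: filterS2 nt nv => y ti.
case: (u y) ti => j t /= ji; case: _ / (esym ji) t => t Ot.
exact: OU.
Qed.

(** * Models of categories of crossed homomorphisms *)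

Lemma crossedHom1 (G Pi : topGroupType) (A : groupAct G Pi) (alpha : crossedHom A) :
  alpha 1 = 1.
Proof. by apply: (mulgI (alpha 1)); have := chM alpha 1 1; rewrite mulg1 act1g mulg1. Qed.

Section CrossedModel.
Variables (G Pi : topGroupType) (A : groupAct G Pi).

(** The category C is, up to the choice and multiplicity of its objects, a full
    subcategory of the category of crossed homomorphisms: [cm_hom] sends an object
    to a crossed homomorphism and [cm_val] is bijective from the morphisms between
    two objects to the isomorphisms of their images.  The last two fields say that
    the source, the target and [cm_val] together embed the morphism space into
    ob C * ob C * Pi; discreteness of the objects is stated as the
    continuity of every map out of them. *)
Record crossedModel (C : topCat) := CrossedModel {
  cm_hom : ob C -> crossedHom A;
  cm_val : mor C -> Pi;
  cm_discrete : forall (T : topologicalType) (u : ob C -> T), continuous u;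
  cm_valP : forall f, crossed_iso_by (cm_hom (src f)) (cm_hom (tgt f)) (cm_val f);
  cm_valM : forall g f, src g = tgt f -> cm_val (comp g f) = cm_val g * cm_val f;
  cm_full : forall x y sigma, crossed_iso_by (cm_hom x) (cm_hom y) sigma ->
    exists f, [/\ src f = x, tgt f = y & cm_val f = sigma];
  cm_inj : forall f g, src f = src g -> tgt f = tgt g ->
    cm_val f = cm_val g -> f = g;
  cm_val_continuous : continuous cm_val;
  cm_continuous : forall (X : topologicalType) (u : X -> mor C),
    continuous (fun x => src (u x)) -> continuous (fun x => tgt (u x)) ->
    continuous (fun x => cm_val (u x)) -> continuous u
}.

Lemma cm_val1 (C : topCat) (M : crossedModel C) x : cm_val M (idm x) = 1.
Proof.
apply: (mulgI (cm_val M (idm x))); rewrite mulg1 -cm_valM ?src_idm ?tgt_idm//.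
by rewrite -{1}[x]tgt_idm comp1m.
Qed.

Section Lift.
Variables (C : topCat) (M : crossedModel C) (x y : ob C) (sigma : Pi).
Hypothesis h : crossed_iso_by (cm_hom M x) (cm_hom M y) sigma.

Definition cm_lift : mor C := projT1 (cid (cm_full h)).

Lemma src_cm_lift : src cm_lift = x.
Proof. by rewrite /cm_lift; case: cid => f []. Qed.
Lemma tgt_cm_lift : tgt cm_lift = y.
Proof. by rewrite /cm_lift; case: cid => f []. Qed.
Lemma cm_val_lift : cm_val M cm_lift = sigma.
Proof. by rewrite /cm_lift; case: cid => f []. Qed.
End Lift.

(** A choice of an isomorphism [s x] from each object x to an object [h x] of
    another model extends to a functor by conjugation with [s]. *)
Section ModelFunctor.
Variables (C D : topCat) (M : crossedModel C) (N : crossedModel D).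
Variables (h : ob C -> ob D) (s : ob C -> Pi).
Hypothesis hs : forall x, crossed_iso_by (cm_hom M x) (cm_hom N (h x)) (s x).

Lemma model_functor_subproof f :
  crossed_iso_by (cm_hom N (h (src f))) (cm_hom N (h (tgt f)))
    (s (tgt f) * cm_val M f * (s (src f))^-1).
Proof.
exact: (crossed_iso_byM (crossed_iso_byM (hs _) (cm_valP M f))
  (crossed_iso_byV (hs _))).
Qed.

Definition model_mor f := cm_lift (model_functor_subproof f).

Lemma src_model_mor f : src (model_mor f) = h (src f).
Proof. exact: src_cm_lift. Qed.
Lemma tgt_model_mor f : tgt (model_mor f) = h (tgt f).
Proof. exact: tgt_cm_lift. Qed.
Lemma val_model_mor f :
  cm_val N (model_mor f) = s (tgt f) * cm_val M f * (s (src f))^-1.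
Proof. exact: cm_val_lift. Qed.

Definition modelE := (src_model_mor, tgt_model_mor, val_model_mor).

Lemma model_mor1 x : model_mor (idm x) = idm (h x).
Proof.
apply: (cm_inj (c := N)); rewrite modelE ?(src_idm, tgt_idm)//.
by rewrite !cm_val1 mulg1 mulgV.
Qed.

Lemma model_morM g f : src g = tgt f ->
  model_mor (comp g f) = comp (model_mor g) (model_mor f).
Proof.
move=> e; have e' : src (model_mor g) = tgt (model_mor f) by rewrite !modelE e.
apply: (cm_inj (c := N)); rewrite ?(cm_valM N e') !modelE.
- by rewrite !src_comp// modelE.
- by rewrite !tgt_comp// modelE.
- by rewrite src_comp// tgt_comp// cm_valM// e !mulgA mulgVK.
Qed.

Lemma model_mor_continuous : continuous model_mor.
Proof.
apply: (cm_continuous (c := N)).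
- under [X in continuous X]eq_fun do rewrite modelE.
  exact: (cts_comp (@src_continuous C) (@cm_discrete _ M _ _)).
- under [X in continuous X]eq_fun do rewrite modelE.
  exact: (cts_comp (@tgt_continuous C) (@cm_discrete _ M _ _)).
- under [X in continuous X]eq_fun do rewrite modelE.
  apply: (@cts_comp _ _ _
    (fun f => (s (tgt f) * cm_val M f, (s (src f))^-1)) (fun p => p.1 * p.2));
    last exact: mulg_continuous.
  apply: continuous_pair.
    apply: (@cts_comp _ _ _
      (fun f => (s (tgt f), cm_val M f)) (fun p => p.1 * p.2));
      last exact: mulg_continuous.
    apply: continuous_pair; last exact: cm_val_continuous.
    exact: (cts_comp (@tgt_continuous C) (@cm_discrete _ M _ s)).
  exact: (cts_comp (@src_continuous C) (@cm_discrete _ M _ (fun x => (s x)^-1))).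
Qed.

Definition model_functor : functor C D := {|
  fsrc := src_model_mor;
  ftgt := tgt_model_mor;
  fidm := model_mor1;
  fcomp := model_morM;
  fob_continuous := @cm_discrete _ M _ h;
  fmor_continuous := model_mor_continuous
|}.

End ModelFunctor.

Section ModelTransformation.
Variables (C D : topCat) (M : crossedModel C) (N : crossedModel D).

Lemma model_nattrans (F F' : functor C D) (t : ob C -> Pi) :
  (forall x, crossed_iso_by (cm_hom N (fob F x)) (cm_hom N (fob F' x)) (t x)) ->
  (forall f, t (tgt f) * cm_val N (fmor F f) = cm_val N (fmor F' f) * t (src f)) ->
  exists a : nattrans C D, [/\ nt_src a = F, nt_tgt a = F' &
    forall x, cm_val N (nt_map a x) = t x].
Proof.
move=> ht nat.
have natural f : comp (cm_lift (ht (tgt f))) (fmor F f)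
    = comp (fmor F' f) (cm_lift (ht (src f))).
  have e1 : src (cm_lift (ht (tgt f))) = tgt (fmor F f).
    by rewrite src_cm_lift ftgt.
  have e2 : src (fmor F' f) = tgt (cm_lift (ht (src f))).
    by rewrite tgt_cm_lift fsrc.
  apply: (cm_inj (c := N)).
  - by rewrite !src_comp// src_cm_lift fsrc.
  - by rewrite !tgt_comp// tgt_cm_lift ftgt.
  - by rewrite !cm_valM// !cm_val_lift.
exists (NatTrans (fun x => src_cm_lift (ht x)) (fun x => tgt_cm_lift (ht x))
  natural (@cm_discrete _ M _ _)); split => //= x.
exact: cm_val_lift.
Qed.

Lemma model_nat_iso (F F' : functor C D) (t : ob C -> Pi) :
  (forall x, crossed_iso_by (cm_hom N (fob F x)) (cm_hom N (fob F' x)) (t x)) ->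
  (forall f, t (tgt f) * cm_val N (fmor F f) = cm_val N (fmor F' f) * t (src f)) ->
  nat_iso F F'.
Proof.
move=> ht nat; have [a [a1 a2 a3]] := model_nattrans ht nat.
have [|b [b1 b2 b3]] := model_nattrans (fun x => crossed_iso_byV (ht x)).
  by move=> f; apply: (mulgI (t (tgt f))); rewrite !mulgA nat mulgV mul1g mulgK.
exists a, b; split => // x.
have e1 : src (nt_map b x) = tgt (nt_map a x) by rewrite nt_srcE nt_tgtE b1 a2.
have e2 : src (nt_map a x) = tgt (nt_map b x) by rewrite nt_srcE nt_tgtE b2 a1.
split; apply: (cm_inj (c := N)); rewrite ?cm_valM// ?a3 ?b3 ?cm_val1 ?mulgV ?mulVg//.
- by rewrite src_comp// src_idm nt_srcE a1.
- by rewrite tgt_comp// tgt_idm nt_tgtE b2.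
- by rewrite src_comp// src_idm nt_srcE b1.
- by rewrite tgt_comp// tgt_idm nt_tgtE a2.
Qed.
End ModelTransformation.

Lemma model_functor_compK (C D : topCat) (M : crossedModel C) (N : crossedModel D)
    (h : ob C -> ob D) (s : ob C -> Pi) (k : ob D -> ob C) (t : ob D -> Pi)
    (hs : forall x, crossed_iso_by (cm_hom M x) (cm_hom N (h x)) (s x))
    (kt : forall y, crossed_iso_by (cm_hom N y) (cm_hom M (k y)) (t y)) :
  nat_iso (functor_comp (model_functor kt) (model_functor hs)) (functor_id C).
Proof.
apply: (model_nat_iso M (t := fun x => (t (h x) * s x)^-1)) => [x|f] /=.
  exact: (crossed_iso_byV (crossed_iso_byM (kt _) (hs x))).
by rewrite !modelE !invgM !mulgA mulgVK mulVg mul1g.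
Qed.

(** Discreteness of the objects makes the chosen functors and transformations
    continuous, so the usual criterion, full faithfulness and essential
    surjectivity, suffices for an equivalence of topological categories. *)
Lemma model_equivalent (C D : topCat) (M : crossedModel C) (N : crossedModel D) :
  (forall x, exists y, crossed_iso (cm_hom M x) (cm_hom N y)) ->
  (forall y, exists x, crossed_iso (cm_hom M x) (cm_hom N y)) ->
  cat_equivalent C D.
Proof.
move=> MN NM.
have /choice[hs hsP] x : exists p : ob D * Pi,
    crossed_iso_by (cm_hom M x) (cm_hom N p.1) p.2.
  by have [y /asboolP[s]] := MN x; exists (y, s).
have /choice[kt ktP] y : exists p : ob C * Pi,
    crossed_iso_by (cm_hom N y) (cm_hom M p.1) p.2.
  by have [x /asboolP[s /crossed_iso_byV]] := NM y; exists (x, s^-1).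
exists (model_functor hsP), (model_functor ktP).
by split; exact: model_functor_compK.
Qed.

End CrossedModel.

(** Continuity of inversion does not follow from the invertibility of all
    morphisms of a topological category, hence it is a field. *)
Record topGroupoid (D : topCat) := TopGroupoid {
  ginv : mor D -> mor D;
  src_ginv : forall f, src (ginv f) = tgt f;
  tgt_ginv : forall f, tgt (ginv f) = src f;
  compVm : forall f, comp (ginv f) f = idm (src f);
  compmV : forall f, comp f (ginv f) = idm (tgt f);
  ginv_continuous : continuous ginv
}.

Section ModelGroupoid.
Variables (G Pi : topGroupType) (A : groupAct G Pi).
Variables (C : topCat) (M : crossedModel A C).

Definition model_inv (f : mor C) : mor C :=
  cm_lift (crossed_iso_byV (cm_valP M f)).

Lemma src_model_inv f : src (model_inv f) = tgt f.
Proof. exact: src_cm_lift. Qed.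
Lemma tgt_model_inv f : tgt (model_inv f) = src f.
Proof. exact: tgt_cm_lift. Qed.
Lemma val_model_inv f : cm_val M (model_inv f) = (cm_val M f)^-1.
Proof. exact: cm_val_lift. Qed.

Lemma model_compVm f : comp (model_inv f) f = idm (src f).
Proof.
have e := src_model_inv f; apply: (cm_inj (c := M)).
- by rewrite src_comp// src_idm.
- by rewrite tgt_comp// tgt_idm tgt_model_inv.
- by rewrite cm_valM// val_model_inv mulVg cm_val1.
Qed.

Lemma model_compmV f : comp f (model_inv f) = idm (tgt f).
Proof.
have e := esym (tgt_model_inv f); apply: (cm_inj (c := M)).
- by rewrite src_comp// src_idm src_model_inv.
- by rewrite tgt_comp// tgt_idm.
- by rewrite cm_valM// val_model_inv mulgV cm_val1.
Qed.

Lemma model_inv_continuous : continuous model_inv.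
Proof.
apply: (cm_continuous (c := M)).
- under [X in continuous X]eq_fun do rewrite src_model_inv.
  exact: tgt_continuous.
- under [X in continuous X]eq_fun do rewrite tgt_model_inv.
  exact: src_continuous.
- under [X in continuous X]eq_fun do rewrite val_model_inv.
  exact: (cts_comp (@cm_val_continuous _ _ _ _ M) (@invg_continuous _)).
Qed.

Definition model_groupoid : topGroupoid C := {|
  src_ginv := src_model_inv;
  tgt_ginv := tgt_model_inv;
  compVm := model_compVm;
  compmV := model_compmV;
  ginv_continuous := model_inv_continuous
|}.

End ModelGroupoid.

(** * The two models: disjoint unions of automorphism groups, and fixed points *)

Section SumModel.
Variables (G Pi : topGroupType) (A : groupAct G Pi).
Variables (I : choiceType) (r : I -> crossedHom A).
Hypothesis r_inj : forall i j, crossed_iso (r i) (r j) -> i = j.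

Local Notation S := (sum_cat (fun i => group_cat (subgroup_type (Aut (r i))))).

Lemma sum_tag_continuous (X : I -> topologicalType) :
  continuous (fun x : {i & X i} => tag x : discrete_topology I).
Proof. by apply: sigT_discrete_continuous => i; exact: cst_continuous. Qed.

Lemma sum_ob_discrete (T : topologicalType) (u : ob S -> T) : continuous u.
Proof.
by apply: sigT_discrete_continuous => i; exact: (@discrete_continuous (discrete_topology unit)).
Qed.

Definition sum_val (f : mor S) : Pi := sgT_val (tagged f).

Lemma sum_val_continuous : continuous sum_val.
Proof. by apply: sigT_discrete_continuous => i; exact: sgT_val_continuous. Qed.

(** Injectivity of r on isomorphism classes is what makes this model full: there
    are no morphisms between different summands. *)
Program Definition sum_model : crossedModel A S := {|
  cm_hom := fun x : ob S => r (tag x);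
  cm_val := sum_val;
  cm_discrete := sum_ob_discrete;
  cm_val_continuous := sum_val_continuous
|}.
Next Obligation. by move=> [i p]; exact: (@sgT_valP _ (Aut (r i)) p). Qed.
Next Obligation.
move=> [i p] [j q] /= /(congr1 (@projT1 _ _))/= e.
by case: _ / e q => q; rewrite /sum_val /= tagged_asE.
Qed.
Next Obligation.
move=> [i []] [j []] sigma /= h.
have e : i = j by apply: r_inj; apply/asboolP; exists sigma.
case: _ / e h => h.
by exists (existT _ i (exist _ sigma (mem_set h))).
Qed.
Next Obligation.
move=> [i p] [j q] /= /(congr1 (@projT1 _ _))/= e _.
by case: _ / e q => q e; rewrite (@sgT_inj _ (Aut (r i)) p q e).
Qed.
Next Obligation.
move=> X u cs ct cv; apply: continuous_sum_subgroup => //.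
exact: (cts_comp cs (@sum_tag_continuous (fun=> discrete_topology unit))).
Qed.

End SumModel.

Section FixedModel.
Variables (G : discreteGroupType) (Pi : topGroupType) (A : groupAct G Pi).
Local Notation C := (fixed_point_category A).
Local Notation Fun := (functor (chaotic G) (group_cat Pi)).

(** Invariance under conjugation, rewritten as equivariance. *)
Lemma fixed_fmor (x : ob C) g a b :
  fmor (val x : Fun) (g * a, g * b) = A g (fmor (val x : Fun) (a, b)).
Proof.
have /(congr1 (fun F : Fun => fmor F (g * a, g * b))) := set_mem (valP x) g.
by rewrite /= !mulKg => <-.
Qed.

Lemma fmor_chaotic (F : Fun) a b c : fmor F (a, c) = fmor F (b, c) * fmor F (a, b).
Proof. exact: (@fcomp _ _ F (b, c) (a, b)). Qed.

Lemma fixed_homM (x : ob C) g h : fmor (val x : Fun) (g * h, 1) =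
  fmor (val x : Fun) (g, 1) * A g (fmor (val x : Fun) (h, 1)).
Proof. by rewrite -fixed_fmor mulg1 -fmor_chaotic. Qed.

Definition fixed_hom (x : ob C) : crossedHom A :=
  CrossedHom (fixed_homM x) (@discrete_continuous G Pi _).

Definition fixed_val (f : mor C) : Pi :=
  nt_map (val f : nattrans (chaotic G) (group_cat Pi)) 1.

(** Equivariance determines a fixed transformation by its component at 1; this is
    also why pointwise convergence reduces to convergence of that component. *)
Lemma nt_map_fixed (f : mor C) g :
  nt_map (val f : nattrans (chaotic G) (group_cat Pi)) g = A g (fixed_val f).
Proof.
have /(congr1 (fun n : nattrans (chaotic G) (group_cat Pi) => nt_map n g)) :=
  set_mem (valP f) g.
by rewrite /= mulVg => <-.
Qed.

Lemma fixed_valP f :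
  crossed_iso_by (fixed_hom (src f)) (fixed_hom (tgt f)) (fixed_val f).
Proof.
move=> g; rewrite -nt_map_fixed.
exact: esym (nt_natural (val f : nattrans (chaotic G) (group_cat Pi)) (g, 1)).
Qed.

Local Notation Nat := (nattrans (chaotic G) (group_cat Pi)).

(** A fixed functor is recovered from its crossed homomorphism. *)
Lemma fmor_fixed_hom (x : ob C) p :
  fmor (val x : Fun) p = (fixed_hom x p.2)^-1 * fixed_hom x p.1.
Proof.
by case: p => a b; rewrite /= (fmor_chaotic (val x : Fun) a b 1) mulKg.
Qed.

Lemma fixed_valM (g f : mor C) : src g = tgt f ->
  fixed_val (comp g f) = fixed_val g * fixed_val f.
Proof.
move=> e; have e' : nt_src (val g : Nat) = nt_tgt (val f : Nat).
  exact: (congr1 val e).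
have E : val (comp g f) = nt_comp (val g : Nat) (val f : Nat).
  exact: (@val_fixed_compose G _ (conj_act (translation_act G) (group_cat_act A)) g f e').
rewrite /fixed_val E.
by have [_ _ ->] := nt_compE e'.
Qed.

Lemma fixed_full (x y : ob C) sigma :
  crossed_iso_by (fixed_hom x) (fixed_hom y) sigma ->
  exists f : mor C, [/\ src f = x, tgt f = y & fixed_val f = sigma].
Proof.
move=> h; have tt_eq (u v : ob (group_cat Pi)) : u = v by case: u; case: v.
have nat (p : mor (chaotic G)) :
    comp (A (tgt p) sigma : mor (group_cat Pi)) (fmor (val x : Fun) p)
    = comp (fmor (val y : Fun) p) (A (src p) sigma : mor (group_cat Pi)).
  rewrite !fmor_fixed_hom /= -mulgA h mulgA.
  by apply: (mulgI (fixed_hom y p.2)); rewrite !mulgA mulgV mul1g h mulgK.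
pose n : Nat := @NatTrans (chaotic G) (group_cat Pi) (val x : Fun) (val y : Fun)
  (fun a => A a sigma) (fun=> tt_eq _ _) (fun=> tt_eq _ _) nat
  (@discrete_continuous G Pi _).
have fn : fixed_mor (conj_act (translation_act G) (group_cat_act A)) n.
  move=> g; apply: nattrans_eq => [||a] /=.
  - exact: (set_mem (valP x) g).
  - exact: (set_mem (valP y) g).
  - by rewrite -actMg mulVKg.
exists (exist _ n (mem_set fn) : mor C); split; [exact: val_inj|exact: val_inj|].
exact: act1g.
Qed.

Lemma fixed_inj (f g : mor C) : src f = src g -> tgt f = tgt g ->
  fixed_val f = fixed_val g -> f = g.
Proof.
move=> /(congr1 val)/= es /(congr1 val)/= et ev; apply: val_inj.
by apply: nattrans_eq => // a; rewrite !nt_map_fixed ev.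
Qed.

Lemma fixed_val_continuous : continuous fixed_val.
Proof.
exact: (cts_comp (@initial_continuous _ _ _)
  (@nt_map_continuous (chaotic G) (group_cat Pi) (1 : G))).
Qed.

Lemma fixed_continuous (X : topologicalType) (u : X -> mor C) :
  continuous (fun x => src (u x)) -> continuous (fun x => tgt (u x)) ->
  continuous (fun x => fixed_val (u x)) -> continuous u.
Proof.
move=> cs ct cv; apply: continuous_comp_initial; apply: nattrans_continuous.
- exact: (cts_comp cs (@initial_continuous _ _ _)).
- exact: (cts_comp ct (@initial_continuous _ _ _)).
- move=> a; under [X in continuous X]eq_fun do rewrite /= nt_map_fixed.
  exact: (cts_comp cv (@act_continuousr _ _ A a)).
Qed.

Definition fixed_model : crossedModel A C := {|
  cm_hom := fixed_hom;
  cm_val := fixed_val;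
  cm_discrete := @subspace_discrete_continuous (discrete_topology Fun) _;
  cm_valP := fixed_valP;
  cm_valM := fixed_valM;
  cm_full := fixed_full;
  cm_inj := fixed_inj;
  cm_val_continuous := fixed_val_continuous;
  cm_continuous := fixed_continuous
|}.

(** The functor of [alpha] is (a, b) |-> alpha b^-1 * alpha a, for which the crossed
    homomorphism identity becomes invariance under G. *)
Lemma crossedHom_fixed (alpha : crossedHom A) :
  exists x : ob C, forall g, fixed_hom x g = alpha g.
Proof.
pose m (p : mor (chaotic G)) : mor (group_cat Pi) := (alpha p.2)^-1 * alpha p.1.
have m1 x : m (idm x) = idm (tt : ob (group_cat Pi)) by rewrite /m mulVg.
have mM (q p : mor (chaotic G)) : src q = tgt p -> m (comp q p) = comp (m q) (m p).
  by move=> /= e; rewrite /m /= e !mulgA mulgK.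
have cm : continuous m.
  apply: (@cts_comp _ _ _ (fun p : mor (chaotic G) => ((alpha p.2)^-1, alpha p.1))
    (fun p => p.1 * p.2)); last exact: mulg_continuous.
  apply: continuous_pair.
    exact: (cts_comp (@cts_snd G G) (@discrete_continuous G Pi (fun a => (alpha a)^-1))).
  exact: (cts_comp (@cts_fst G G) (@discrete_continuous G Pi alpha)).
pose F : Fun := @Functor (chaotic G) (group_cat Pi) (fun=> tt) m
  (fun=> erefl) (fun=> erefl) m1 mM (@discrete_continuous G _ _) cm.
have fF : fixed_ob (conj_act (translation_act G) (group_cat_act A)) F.
  move=> g; apply: functor_eq => // -[a b] /=.
  rewrite /m /= actg_mul actgV.
  have E c : A g (alpha (g^-1 * c)) = (alpha g)^-1 * alpha c.
    by have := chM alpha g (g^-1 * c); rewrite mulVKg => ->; rewrite mulKg.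
  by rewrite !E invgM invgK mulgA mulgK.
exists (exist _ F (mem_set fF) : ob C) => g.
by rewrite /= /m /= crossedHom1 invg1 mul1g.
Qed.

Lemma fixed_cat_sum (I : choiceType) (r : I -> crossedHom A) :
  (forall i j, crossed_iso (r i) (r j) -> i = j) ->
  (forall alpha, exists i, crossed_iso alpha (r i)) ->
  cat_equivalent C (sum_cat (fun i => group_cat (subgroup_type (Aut (r i))))).
Proof.
move=> r_inj r_surj; apply: (model_equivalent (M := fixed_model) (N := sum_model r_inj)).
  by move=> x; have [i ?] := r_surj (fixed_hom x); exists (existT _ i tt).
move=> [i y]; have [x xi] := crossedHom_fixed (r i).
exists x; apply/asboolP; exists 1 => g.
by rewrite actg1 mulg1 mul1g; exact: esym (xi g).
Qed.

End FixedModel.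

(** * Complements of Pi as graphs of crossed homomorphisms *)

Lemma subgroup_eq (P : groupType) (H K : subgroup P) :
  sg_set H = sg_set K -> H = K.
Proof.
case: H K => [S a b c] [T a' b' c'] /= E; move: E a' b' c' => <- *.
by congr Subgroup; exact: Prop_irrelevance.
Qed.

Section Graphs.
Variables (G Pi : topGroupType) (A : groupAct G Pi).
Local Notation Gamma := (sdprod A).
Implicit Types (alpha beta : crossedHom A).

Definition graph (alpha : G -> Pi) : set Gamma := [set x | x.1 = alpha x.2].

(** In Gamma, conjugation by sigma takes (alpha g, g) to
    (sigma * alpha g * (g . sigma)^-1, g). *)
Lemma conj_graphP alpha beta sigma :
  conj_set (sd_inl A sigma) (graph alpha) = graph beta <->
  crossed_iso_by alpha beta sigma.
Proof.
have conjE (x : Gamma) : sd_inl A sigma * x * (sd_inl A sigma)^-1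
    = (sigma * x.1 * (A x.2 sigma)^-1, x.2).
  rewrite -sd_inlV [LHS](_ : _ = sd_mul (sd_mul (sd_inl A sigma) x) (sd_inl A sigma^-1))//.
  by rewrite /sd_mul /= act1g mul1g mulg1 actgV.
split => [E g|h].
  have : graph beta (sd_inl A sigma * (alpha g, g) * (sd_inl A sigma)^-1).
    by rewrite -E; exists (alpha g, g).
  by rewrite conjE /graph /= => <-; rewrite mulgVK.
apply/seteqP; split => [_ [x xa <-]|[b g] /= bg].
  by rewrite conjE /graph /= xa -h mulgK.
by exists (alpha g, g) => //; rewrite conjE /= -h mulgK -bg.
Qed.

Lemma capPi_normalizer_graph (L : subgroup Gamma) alpha :
  sg_set L = graph alpha -> capPi (normalizer L) = Aut alpha.
Proof.
move=> La; apply: subgroup_eq; apply/seteqP.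
by split => sigma; rewrite /= /normalizes /= La conj_graphP.
Qed.

End Graphs.

Lemma crossed_classP (G Pi : topGroupType) (A : groupAct G Pi) (alpha beta : crossedHom A) :
  crossed_class alpha = crossed_class beta <-> crossed_iso alpha beta.
Proof. by split => ?; apply/(@eqmodP _ (crossed_iso_equiv A)). Qed.

Lemma conj_classP (G Pi : topGroupType) (A : groupAct G Pi) (L M : complement A) :
  conj_class L = conj_class M <-> Pi_conj L M.
Proof. by split => ?; apply/(@eqmodP _ (Pi_conj_equiv A)). Qed.

Section DiscreteGraphs.
Variables (G : discreteGroupType) (Pi : topGroupType) (A : groupAct G Pi).
Local Notation Gamma := (sdprod A).

(** Surjectivity onto G gives an element of L over each g, and the trivial
    intersection with Pi makes it unique; uniqueness forces the crossed
    homomorphism identity. *)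
Lemma complement_graph (L : complement A) :
  exists alpha : crossedHom A, sg_set L = graph alpha.
Proof.
have /choice[a aP] g : exists s : Pi, sg_set L ((s, g) : Gamma).
  have [[s h] Ls /= <-] : (sd_proj (A := A) @` sg_set L) g by rewrite cp_onto.
  by exists s.
have aE s g : sg_set L ((s, g) : Gamma) -> s = a g.
  move=> Lsg; have := sgM (aP g) (sgV Lsg).
  rewrite [_ * _](_ : _ = sd_inl A (a g * s^-1)).
    move=> h; have : [set 1] (a g * s^-1) by rewrite -(cp_trivial L).
    by move=> /= /divg1_eq.
  rewrite [LHS](_ : _ = sd_mul (a g, g) (sd_inv (s, g : G)))//.
  by rewrite /sd_mul /sd_inv /= -actMg !mulgV act1g.
have aM g h : a (g * h) = a g * A g (a h).
  by rewrite -(aE _ _ (sgM (aP g) (aP h))).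
exists (CrossedHom aM (@discrete_continuous G Pi a)).
by apply/seteqP; split => -[s g] /=; [exact: aE|rewrite /graph /= => ->; exact: aP].
Qed.

(** The graph is the preimage of 1 under (sigma, g) |-> sigma * alpha g^-1, so it is
    closed as soon as 1 is. *)
Lemma graph_complement (alpha : crossedHom A) : closed [set 1 : Pi] ->
  exists L : complement A, sg_set L = graph alpha.
Proof.
move=> cl1.
have g1 : graph (A := A) alpha 1 by rewrite /graph /= crossedHom1.
have gM x y : graph (A := A) alpha x -> graph (A := A) alpha y -> graph (A := A) alpha (x * y).
  by rewrite /graph /= chM => <- <-.
have gV x : graph (A := A) alpha x -> graph (A := A) alpha x^-1.
  rewrite /graph /= => xa.
  change (A x.2^-1 x.1^-1 = alpha x.2^-1); rewrite xa.
  apply: (mulgI (A x.2^-1 (alpha x.2))); rewrite actgV mulgV.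
  apply: (mulgI (alpha x.2^-1)).
  by rewrite mulgA mulg1 -chM mulVg crossedHom1 mul1g.
pose H : subgroup Gamma := Subgroup g1 gM gV.
have cH : closed (sg_set H).
  rewrite (_ : sg_set H = (fun x : Gamma => x.1 * (alpha x.2)^-1) @^-1` [set 1]).
    apply: closed_comp => [x _|//].
    move: x; apply: (@cts_comp Gamma _ _ (fun x => (x.1, (alpha x.2)^-1))
      (fun p => p.1 * p.2)); last exact: mulg_continuous.
    apply: continuous_pair; first exact: cts_fst.
    exact: (cts_comp (@cts_snd Pi G) (@discrete_continuous G Pi (fun a => (alpha a)^-1))).
  apply/seteqP; split => x; rewrite /graph /=; last exact: divg1_eq.
  by move=> ->; rewrite mulgV.
have tH : sg_set (capPi H) = [set 1].
  by apply/seteqP; split => x; rewrite /= /graph /= crossedHom1.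
have oH : sd_proj (A := A) @` sg_set H = [set: G].
  by apply/seteqP; split => // g _; exists (alpha g, g).
by exists (Complement cH tH oH).
Qed.

Lemma fixed_cat_H1 (rep : H1 A -> crossedHom A) :
  cancel rep (@crossed_class G Pi A) ->
  cat_equivalent (fixed_point_category A)
    (sum_cat (fun x : H1 A => group_cat (subgroup_type (Aut (rep x))))).
Proof.
move=> repK; apply: fixed_cat_sum => [i j ij|alpha].
  by rewrite -(repK i) -(repK j); apply/crossed_classP.
by exists (crossed_class alpha); apply/crossed_classP; rewrite repK.
Qed.

(** By [conj_graphP], two complements are Pi-conjugate exactly when the crossed
    homomorphisms that they are graphs of are isomorphic. *)
Lemma complement_crossedHoms : closed [set 1 : Pi] ->
  forall (rep : conj_classes A -> complement A),
  cancel rep (@conj_class G Pi A) -> exists r : conj_classes A -> crossedHom A,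
  [/\ forall i j, crossed_iso (r i) (r j) -> i = j,
      forall alpha, exists i, crossed_iso alpha (r i) &
      (fun c => capPi (normalizer (rep c))) = fun c => Aut (r c)].
Proof.
move=> cl1 rep repK.
have /choice[r rP] c := complement_graph (rep c).
exists r; split => [i j /asboolP[s ij]|alpha|].
- rewrite -(repK i) -(repK j); apply/conj_classP/asboolP; exists s.
  by rewrite !rP; apply/conj_graphP.
- have [L La] := graph_complement alpha cl1.
  exists (conj_class L); apply/asboolP.
  have /conj_classP/asboolP[s] : conj_class L = conj_class (rep (conj_class L)).
    by rewrite repK.
  by rewrite La rP => /conj_graphP; exists s.
- by apply/funext => c; exact: capPi_normalizer_graph.
Qed.

End DiscreteGraphs.

(** * Maps and homotopies out of a geometric realization *)

Local Close Scope group_scope.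
Local Open Scope ring_scope.
Import Order.TTheory GRing.Theory Num.Theory numFieldNormedType.Exports.

Lemma continuous_sigT_prod (I : choiceType) (X : I -> topologicalType)
    (Z T : topologicalType) (u : {i & X i} * Z -> T) :
  (forall i, continuous (fun p : X i * Z => u (existT _ i p.1, p.2))) ->
  continuous u.
Proof.
move=> cu [[i x] z] U nU; have [[P Q] /= [nP nQ] PQ] := cu i (x, z) U nU.
exists (existT _ i @` P, Q) => /=; first by split => //; exact: existT_nbhs.
by move=> [_ w] /= [[x' Px' <-] Qw]; exact: (PQ (x', w)).
Qed.

Section QuotientCylinder.
Variables (R : realType) (T : topologicalType) (Q0 : quotType T).
Local Notation Q := (quotient_topology Q0).

(** Whitehead's lemma for the line.  Given an open U and a point of its preimage,
    take a compact neighbourhood J of the second coordinate such that {y} * J lands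
    in U.  By the tube lemma, the points z for which {z} * J lands in U form an open
    subset of the quotient. *)
Lemma continuous_quotient_cylinder (Y : topologicalType) (f : Q * R -> Y) :
  continuous (fun p : T * R => f (\pi_Q p.1, p.2)) -> continuous f.
Proof.
set c := (fun p : T * R => _) => cc.
suff H z s (U : set Y) : open U -> U (f (z, s)) ->
    \forall p \near (z, s), U (f p).
  move=> [z s] U; rewrite nbhsE => -[V [oV Vf] VU].
  by apply: filterS (H z s V oV Vf) => p; exact: VU.
move=> oU; rewrite -[z]reprK; set y := repr z => Uf.
have [[P S] /= [nP nS] PS] : nbhs (y, s) (c @^-1` U).
  by apply: cc; exact: open_nbhs_nbhs.
have [e e0 eS] := (@nbhs_ballP R R s S).1 nS.
pose J : set R := `[s - e / 2, s + e / 2]%classic.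
have e2 : 0 < e / 2 by exact: divr_gt0.
have JS : J `<=` S.
  move=> j; rewrite /J /= in_itv /= => /andP[j1 j2]; apply: eS.
  by rewrite /ball /= ltr_norml; apply/andP; split; lra.
have nJ : nbhs s J.
  have : s \in `]s - e / 2, s + e / 2[ by rewrite in_itv /=; apply/andP; split; lra.
  move=> /near_in_itvoo; apply: filterS => j.
  by rewrite /J /= !in_itv /= => /andP[j1 j2]; rewrite !ltW.
pose V : set Q := [set z | forall j, J j -> U (f (z, j))].
have oV : open V.
  change (open (\pi_Q @^-1` V)); rewrite openE => y' Vy'.
  have /compact_near_coveringP := @segment_compact R (s - e / 2) (s + e / 2).
  apply => j Jj.
  have : nbhs (y', j) (c @^-1` U).
    by apply: cc; apply: open_nbhs_nbhs; split => //; exact: Vy'.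
  move=> [[P' S'] /= [nP' nS'] PS']; exists (S', P') => //= -[a b] /= [Sa Pb].
  exact: (PS' (b, a)).
exists (V, J) => /=.
  split => //; apply: open_nbhs_nbhs; split => // j Jj.
  by apply: (PS (y, j)); split => /=; [exact: nbhs_singleton|exact: JS].
by move=> [z' j] /= [Vz' Jj]; exact: Vz'.
Qed.
End QuotientCylinder.

Section RealizationMaps.
Variables (R : realType) (X : simplicialSpace).
Local Notation RX := (realization R X).

Definition cell_point (c : cells R X) : RX :=
  \pi_(quotient_topology {eq_quot glued_equiv R X}) c.

Lemma cell_point_continuous : continuous cell_point.
Proof. exact: pi_continuous. Qed.

Lemma cell_point_surj (z : RX) : exists c, cell_point c = z.
Proof. by exists (repr z); exact: reprK. Qed.

Lemma cell_point_glue m n (theta : ordmap m n) x (t : set_type (@std_simplex R m)) :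
  cell_point (existT _ m (sop theta x, t)) =
  cell_point (existT _ n (x, simplex_map theta t)).
Proof.
apply/(@eqmodP _ (glued_equiv R X)); apply/asboolP; apply: rst_step.
exact: Glue.
Qed.

Definition respects_glue (Y : Type) (f : cells R X -> Y) : Prop :=
  forall m n (theta : ordmap m n) x (t : set_type (@std_simplex R m)),
  f (existT _ m (sop theta x, t)) = f (existT _ n (x, simplex_map theta t)).

(** [repr] picks a cell over each point; for maps that respect the gluing the choice
    does not matter. *)
Definition realization_lift (Y : Type) (f : cells R X -> Y) (z : RX) : Y :=
  f (repr z).

Lemma realization_liftE (Y : Type) (f : cells R X -> Y) :
  respects_glue f -> forall c, realization_lift f (cell_point c) = f c.
Proof.
move=> fg c; have /(@eqmodP _ (glued_equiv R X))/asboolP :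
    cell_point (repr (cell_point c)) = cell_point c by exact: reprK.
rewrite /realization_lift; move: (repr _) => c0.
elim=> [_ _ [m n theta x t]|//|a b _ ->//|a b d _ -> _ ->//].
exact: fg.
Qed.

Lemma realization_lift_continuous (Y : topologicalType) (f : cells R X -> Y) :
  respects_glue f -> continuous f -> continuous (realization_lift f).
Proof.
move=> fg cf; apply/quotient_continuous.
by rewrite (_ : _ \o _ = f)//; apply/funext => c; exact: realization_liftE.
Qed.

Lemma realization_homotopy_continuous (Y : topologicalType)
    (h : cells R X * R -> Y) :
  (forall s, respects_glue (fun c => h (c, s))) -> continuous h ->
  continuous (fun p : RX * R => realization_lift (fun c => h (c, p.2)) p.1).
Proof.
move=> hg ch; apply: continuous_quotient_cylinder.
rewrite (_ : (fun _ => _) = h)//; apply/funext => -[c s] /=.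
exact: (realization_liftE (hg s)).
Qed.
End RealizationMaps.

(** * Functoriality of the classifying space *)

Lemma simplex_continuous (C : topCat) n (Z : topologicalType)
    (u : Z -> simplex C n) :
  (forall i, continuous (fun z => fob (u z) i)) ->
  (forall f, continuous (fun z => fmor (u z) f)) -> continuous u.
Proof.
move=> co cm; apply: continuous_comp_initial.
by apply: continuous_pair; apply: continuous_ptws.
Qed.

Section ClassifyingMaps.
Variable R : realType.

Definition nerve_point (C : topCat) n (x : simplex C n)
    (t : set_type (@std_simplex R n)) : B R C :=
  @cell_point R (nerve C) (existT _ n (x, t)).

Lemma nerve_point_glue (C : topCat) m n (theta : ordmap m n) (x : simplex C n) t :
  nerve_point (functor_comp x (ord_functor theta)) t =
  nerve_point x (simplex_map theta t).
Proof. exact: (@cell_point_glue R (nerve C) m n theta x t). Qed.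

Lemma nerve_point_continuous (C : topCat) n :
  continuous (fun p : simplex C n * set_type (@std_simplex R n) => nerve_point p.1 p.2).
Proof.
rewrite (_ : (fun _ => _) =
    (fun p => @cell_point R (nerve C) (existT _ n p))); last by apply/funext => -[].
exact: (cts_comp (@existT_continuous _ _ n) (@cell_point_continuous R (nerve C))).
Qed.

Section Bmap.
Variables (C D : topCat) (F : functor C D).

Definition Bcell (c : cells R (nerve C)) : B R D :=
  nerve_point (functor_comp F (tagged c).1) (tagged c).2.
Lemma Bcell_glue : respects_glue Bcell.
Proof.
move=> m n theta x t; rewrite /Bcell /= -nerve_point_glue.
by congr nerve_point; exact: functor_eq.
Qed.

Definition Bmap : B R C -> B R D := realization_lift Bcell.

Lemma BmapE n (x : simplex C n) t :
  Bmap (nerve_point x t) = nerve_point (functor_comp F x) t.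
Proof. by exact: (realization_liftE Bcell_glue). Qed.

Lemma Bmap_continuous : continuous Bmap.
Proof.
apply: realization_lift_continuous; first exact: Bcell_glue.
apply: sigT_discrete_continuous => n.
apply: (@cts_comp _ _ _ (fun p : simplex C n * set_type (@std_simplex R n) =>
  (functor_comp F p.1 : simplex D n, p.2)) (fun p => nerve_point p.1 p.2));
  last exact: nerve_point_continuous.
  apply: continuous_pair; last exact: cts_snd.
  apply: (cts_comp (@cts_fst _ _)); apply: simplex_continuous => i.
    exact: (cts_comp (@simplex_ob_continuous _ _ i) (@fob_continuous _ _ F)).
  exact: (cts_comp (@simplex_mor_continuous _ _ i) (@fmor_continuous _ _ F)).
Qed.

End Bmap.

Lemma B_ext (C : topCat) (Y : Type) (f g : B R C -> Y) :
  (forall n (x : simplex C n) t,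
    f (nerve_point x t) = g (nerve_point x t)) ->
  f =1 g.
Proof. by move=> fg z; have [[n [x t]] <-] := cell_point_surj z; exact: fg. Qed.

Lemma Bmap_id (C : topCat) : Bmap (functor_id C) =1 id.
Proof.
apply: B_ext => n x t; rewrite BmapE.
by rewrite (_ : functor_comp _ x = x)//; exact: functor_eq.
Qed.

Lemma Bmap_comp (C D E : topCat) (K : functor D E) (F : functor C D) :
  Bmap (functor_comp K F) =1 Bmap K \o Bmap F.
Proof.
apply: B_ext => n x t; rewrite /= !BmapE.
by congr nerve_point; exact: functor_eq.
Qed.

End ClassifyingMaps.

(** In a groupoid, a family of morphisms e_v with a common source spans a simplex:
    its vertices are the targets and its edges are e_w * e_v^-1.  Functoriality is
    then automatic, and so is continuity in e. *)
Section Cone.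
Variables (D : topCat) (Gd : topGroupoid D) (N : nat).

Section ConeDef.
Variables (a : ob D) (e : 'I_N.+1 -> mor D).
Hypothesis ea : forall v, src (e v) = a.

Definition cone_mor (f : ord_arrow N) : mor D :=
  comp (e (val f).2) (ginv Gd (e (val f).1)).

Lemma cone_composable v w : src (e w) = tgt (ginv Gd (e v)).
Proof. by rewrite tgt_ginv !ea. Qed.

Lemma src_cone_mor f : src (cone_mor f) = tgt (e (val f).1).
Proof. by rewrite src_comp ?src_ginv//; exact: cone_composable. Qed.

Lemma tgt_cone_mor f : tgt (cone_mor f) = tgt (e (val f).2).
Proof. by rewrite tgt_comp//; exact: cone_composable. Qed.

Lemma cone_mor_comp (f : ord_arrow N) : comp (cone_mor f) (e (val f).1) = e (val f).2.
Proof.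
rewrite -compA ?compVm ?src_ginv//; last exact: cone_composable.
by rewrite ea -(ea (val f).2) compm1.
Qed.

Program Definition cone : simplex D N := {|
  fob := (fun v => tgt (e v)) : ob (ord_cat N) -> ob D;
  fmor := cone_mor : mor (ord_cat N) -> mor D
|}.
Next Obligation. exact: src_cone_mor. Qed.
Next Obligation. exact: tgt_cone_mor. Qed.
Next Obligation. by move=> v; rewrite /cone_mor /= compmV. Qed.
Next Obligation.
move=> g f; rewrite [src g]/= [tgt f]/= => gf.
change (cone_mor (ord_comp g f) = comp (cone_mor g) (cone_mor f)).
rewrite {1}/cone_mor val_ord_comp//= -(cone_mor_comp g) -compA ?gf//.
  by rewrite src_cone_mor gf.
exact: cone_composable.
Qed.
Next Obligation. exact: (@discrete_continuous (discrete_topology _)). Qed.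
Next Obligation. exact: (@discrete_continuous (discrete_topology _)). Qed.

End ConeDef.

(** Used to recognize a given simplex as a cone, which is how simplices with
    different descriptions are identified below. *)
Lemma cone_unique (a : ob D) (e : 'I_N.+1 -> mor D) (ea : forall v, src (e v) = a)
    (y : simplex D N) : (forall v, fob y v = tgt (e v)) ->
  (forall f : ord_arrow N, comp (fmor y f) (e (val f).1) = e (val f).2) ->
  y = cone ea.
Proof.
move=> yo ym; apply: functor_eq => [//|f]; rewrite /= /cone_mor -(ym f).
have c1 : src (fmor y f) = tgt (e (val f).1) by rewrite fsrc yo.
by rewrite -compA ?tgt_ginv// compmV -c1 compm1.
Qed.

End Cone.

(** * The homotopy of a natural transformation between groupoids *)

(** The ordinal join of [n] with itself is [2n+1], written n + n.+1 so that its
    vertex type is convertible to 'I_(n.+1 + n.+1) and [split] applies. *)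
Section Join.

Definition join_dim n := (n + n.+1)%N.

Definition join_case n (T : Type) (f g : 'I_n.+1 -> T)
    (v : 'I_(join_dim n).+1) : T :=
  match @fintype.split n.+1 n.+1 v with inl i => f i | inr i => g i end.

Definition join_l n (i : 'I_n.+1) : 'I_(join_dim n).+1 := @lshift n.+1 n.+1 i.
Definition join_r n (i : 'I_n.+1) : 'I_(join_dim n).+1 := @rshift n.+1 n.+1 i.

Lemma join_caseP n (P : 'I_(join_dim n).+1 -> Prop) :
  (forall i, P (join_l i)) -> (forall i, P (join_r i)) -> forall v, P v.
Proof.
by move=> Pl Pr v; have := @splitK n.+1 n.+1 v; case: fintype.split => i <-;
  [exact: Pl|exact: Pr].
Qed.

Lemma join_case_l n T (f g : 'I_n.+1 -> T) i : join_case f g (join_l i) = f i.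
Proof. by rewrite /join_case (@unsplitK n.+1 n.+1 (inl i)). Qed.
Lemma join_case_r n T (f g : 'I_n.+1 -> T) i : join_case f g (join_r i) = g i.
Proof. by rewrite /join_case (@unsplitK n.+1 n.+1 (inr i)). Qed.

Definition join_caseE := (join_case_l, join_case_r).

Lemma join_ll n (i j : 'I_n.+1) : (join_l i <= join_l j)%N = (i <= j)%N.
Proof. by []. Qed.
Lemma join_rr n (i j : 'I_n.+1) : (join_r i <= join_r j)%N = (i <= j)%N.
Proof. exact: (leq_add2l n.+1). Qed.
Lemma join_lr n (i j : 'I_n.+1) : (join_l i <= join_r j)%N.
Proof. by apply: (@leq_trans n.+1); [exact: ltnW (ltn_ord i)|exact: leq_addr]. Qed.
Lemma join_rl n (i j : 'I_n.+1) : (join_r i <= join_l j)%N = false.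
Proof. by apply/negbTE; rewrite -ltnNge; apply: (@leq_trans n.+1 j.+1) => //; exact: leq_addr. Qed.

Lemma join_l_eq n (i j : 'I_n.+1) : (join_l i == join_l j) = (i == j).
Proof. exact: (inj_eq (@lshift_inj n.+1 n.+1)). Qed.
Lemma join_r_eq n (i j : 'I_n.+1) : (join_r i == join_r j) = (i == j).
Proof. exact: (inj_eq (@rshift_inj n.+1 n.+1)). Qed.
Lemma join_rl_eq n (i j : 'I_n.+1) : (join_r i == join_l j) = false.
Proof. exact: (@eq_rlshift n.+1 n.+1). Qed.
Lemma join_lr_eq n (i j : 'I_n.+1) : (join_l i == join_r j) = false.
Proof. exact: (@eq_lrshift n.+1 n.+1). Qed.

Definition join_eqE := (join_l_eq, join_r_eq, join_rl_eq, join_lr_eq).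

Definition join_map_fun m n (theta : ordmap m n) :=
  join_case (fun i => join_l (theta i)) (fun i => join_r (theta i)).

Lemma join_map_homo m n (theta : ordmap m n) :
  {homo join_map_fun theta : i j / (i <= j)%N}.
Proof.
elim/join_caseP => i; elim/join_caseP => j; rewrite /join_map_fun !join_caseE.
- by rewrite !join_ll; exact: om_homo.
- by move=> _; exact: join_lr.
- by rewrite join_rl.
- by rewrite !join_rr; exact: om_homo.
Qed.

Definition join_map m n (theta : ordmap m n) :
  ordmap (join_dim m) (join_dim n) := OrdMap (@join_map_homo m n theta).

Lemma join_l_homo n : {homo @join_l n : i j / (i <= j)%N}. Proof. by []. Qed.
Lemma join_r_homo n : {homo @join_r n : i j / (i <= j)%N}.
Proof. by move=> i j; rewrite join_rr. Qed.

Definition join_lmap n : ordmap n (join_dim n) := OrdMap (@join_l_homo n).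
Definition join_rmap n : ordmap n (join_dim n) := OrdMap (@join_r_homo n).

Lemma join_sum n (T : nmodType) (P : pred 'I_(join_dim n).+1)
    (u : 'I_(join_dim n).+1 -> T) :
  \sum_(v | P v) u v =
  \sum_(i | P (join_l i)) u (join_l i) + \sum_(i | P (join_r i)) u (join_r i).
Proof. exact: (@big_split_ord _ _ _ n.+1 n.+1). Qed.

End Join.

Section JoinWeights.
Variable R : realType.

(** Clamping the time parameter makes the homotopy total and continuous on the whole
    line, which spares a separate treatment of the unit interval. *)
Definition clamp (s : R) : R := Num.min 1 (Num.max 0 s).

Lemma clamp_ge0 s : 0 <= clamp s.
Proof. by rewrite /clamp le_min ler01 le_max lexx. Qed.
Lemma clamp_le1 s : clamp s <= 1.
Proof. by rewrite /clamp ge_min lexx. Qed.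
Lemma clamp0 : clamp 0 = 0.
Proof. by rewrite /clamp maxxx min_r. Qed.
Lemma clamp1 : clamp 1 = 1.
Proof. by rewrite /clamp max_r// minxx. Qed.
Lemma clamp_continuous : continuous clamp.
Proof.
by move=> s; apply: continuous_min; [exact: cst_continuous|
  apply: continuous_max; [exact: cst_continuous|exact: id]].
Qed.

Definition join_weight_fun n (t : 'I_n.+1 -> R) (s : R) : 'I_(join_dim n).+1 -> R :=
  join_case (fun i => (1 - clamp s) * t i) (fun i => clamp s * t i).

Lemma join_weight_subproof n (t : set_type (@std_simplex R n)) s :
  join_weight_fun (val t) s \in @std_simplex R (join_dim n).
Proof.
have [t0 t1] := set_mem (valP t); apply/mem_set; split.
  by elim/join_caseP => i; rewrite /join_weight_fun join_caseE mulr_ge0 ?t0//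
    ?subr_ge0 ?clamp_le1 ?clamp_ge0.
rewrite (join_sum predT) /join_weight_fun.
under eq_bigr do rewrite join_caseE.
under [X in _ + X]eq_bigr do rewrite join_caseE.
by rewrite -!mulr_sumr t1 !mulr1 subrK.
Qed.

Definition join_weight n (t : set_type (@std_simplex R n)) s :
  set_type (@std_simplex R (join_dim n)) :=
  exist _ (join_weight_fun (val t) s) (join_weight_subproof t s).

Lemma simplex_ext n (t u : set_type (@std_simplex R n)) : val t =1 val u -> t = u.
Proof. by move=> tu; apply: val_inj; apply/funext. Qed.

Lemma join_weight0 n (t : set_type (@std_simplex R n)) :
  join_weight t 0 = simplex_map (join_lmap n) t.
Proof.
apply: simplex_ext; elim/join_caseP => i; rewrite /= /join_weight_fun clamp0 join_caseE.
  by rewrite subr0 mul1r (big_pred1 i)// => j; exact: join_l_eq.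
by rewrite mul0r big_pred0// => j; exact: join_lr_eq.
Qed.

Lemma join_weight1 n (t : set_type (@std_simplex R n)) :
  join_weight t 1 = simplex_map (join_rmap n) t.
Proof.
apply: simplex_ext; elim/join_caseP => i; rewrite /= /join_weight_fun clamp1 join_caseE.
  by rewrite subrr mul0r big_pred0// => j; exact: join_rl_eq.
by rewrite mul1r (big_pred1 i)// => j; exact: join_r_eq.
Qed.

Lemma join_weight_map m n (theta : ordmap m n) (t : set_type (@std_simplex R m)) s :
  simplex_map (join_map theta) (join_weight t s) = join_weight (simplex_map theta t) s.
Proof.
apply: simplex_ext; elim/join_caseP => i;
  rewrite /= join_sum /= /join_weight_fun join_caseE mulr_sumr.
- rewrite [X in _ + X]big_pred0 => [|j]; last by rewrite /join_map_fun join_caseE join_eqE.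
  by rewrite addr0; apply: eq_big => j *; rewrite /join_map_fun join_caseE ?join_eqE.
- rewrite big_pred0 => [|j]; last by rewrite /join_map_fun join_caseE join_eqE.
  by rewrite add0r; apply: eq_big => j *; rewrite /join_map_fun join_caseE ?join_eqE.
Qed.

Lemma join_weight_continuous n :
  continuous (fun p : set_type (@std_simplex R n) * R => join_weight p.1 p.2).
Proof.
apply: continuous_comp_initial; apply: continuous_ptws => v.
have ct i : continuous (fun p : set_type (@std_simplex R n) * R =>
    (val p.1 : {ptws 'I_n.+1 -> R}) i).
  have cv : continuous (fun t : set_type (@std_simplex R n) => (val t : {ptws 'I_n.+1 -> R}) i).
    exact: (cts_comp (@initial_continuous _ _ _) (@ptws_eval_continuous _ _ i)).
  exact: (cts_comp (@cts_fst _ _) cv).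
have cs : continuous (fun p : set_type (@std_simplex R n) * R => clamp p.2).
  exact: (cts_comp (@cts_snd _ _) clamp_continuous).
elim/join_caseP: v => i.
- rewrite (_ : (fun _ => _) = fun p => (1 - clamp p.2) * val p.1 i); last first.
    by apply/funext => p; exact: join_case_l.
  move=> p; apply: cvgM; last exact: ct.
  by apply: cvgB; [exact: cvg_cst|exact: cs].
- rewrite (_ : (fun _ => _) = fun p => clamp p.2 * val p.1 i); last first.
    by apply/funext => p; exact: join_case_r.
  by move=> p; apply: cvgM; [exact: cs|exact: ct].
Qed.

End JoinWeights.

Lemma comp_cancelr (D : topCat) (Gd : topGroupoid D) (k a b : mor D) :
  src a = tgt k -> src b = tgt k -> comp a k = comp b k -> a = b.
Proof.
move=> ak bk e; have kV : src k = tgt (ginv Gd k) by rewrite tgt_ginv.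
by rewrite -[a]compm1 -[b]compm1 ak bk -(compmV Gd k) !compA// e.
Qed.

Section Prism.
Variables (C D : topCat) (Gd : topGroupoid D) (eta : nattrans C D).
Local Notation F := (nt_src eta).
Local Notation F' := (nt_tgt eta).

Definition arrow0 n (i : 'I_n.+1) : ord_arrow n := exist _ (ord0, i) (leq0n i).

Lemma simplex_arrow0 n (x : simplex C n) (f : ord_arrow n) :
  comp (fmor x f) (fmor x (arrow0 (val f).1)) = fmor x (arrow0 (val f).2).
Proof.
by rewrite -fcomp//; congr (fmor x); apply: val_inj; exact: val_ord_comp.
Qed.

(** The morphisms from F x_0 to the vertices of the simplex
    F x_0, ..., F x_n, F' x_0, ..., F' x_n. *)
Definition prism_leg n (x : simplex C n) : 'I_(join_dim n).+1 -> mor D :=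
  join_case (fun i => fmor F (fmor x (arrow0 i)))
    (fun i => comp (nt_map eta (fob x i)) (fmor F (fmor x (arrow0 i)))).

Lemma prism_leg_composable n (x : simplex C n) (i : 'I_n.+1) :
  src (nt_map eta (fob x i)) = tgt (fmor F (fmor x (arrow0 i))).
Proof. by rewrite nt_srcE !ftgt. Qed.

Lemma src_prism_leg n (x : simplex C n) v :
  src (prism_leg x v) = fob F (fob x (ord0 : 'I_n.+1)).
Proof.
elim/join_caseP: v => i; rewrite /prism_leg join_caseE.
  by rewrite !fsrc.
by rewrite (src_comp (prism_leg_composable x i)) !fsrc.
Qed.

Definition prism n (x : simplex C n) : simplex D (join_dim n) :=
  cone Gd (src_prism_leg x).

Lemma prism_l n (x : simplex C n) :
  functor_comp (prism x) (ord_functor (join_lmap n)) = functor_comp F x.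
Proof.
pose e i := prism_leg x (join_l i).
have eE i : e i = fmor F (fmor x (arrow0 i)) by rewrite /e /prism_leg join_caseE.
have ea i : src (e i) = fob F (fob x (ord0 : 'I_n.+1)) by exact: src_prism_leg.
transitivity (cone Gd ea).
  by apply: functor_eq.
symmetry; apply: cone_unique => [i|f]; rewrite !eE.
  by rewrite !ftgt.
by rewrite -simplex_arrow0 [RHS]fcomp// fsrc ftgt.
Qed.

Lemma prism_r n (x : simplex C n) :
  functor_comp (prism x) (ord_functor (join_rmap n)) = functor_comp F' x.
Proof.
pose e i := prism_leg x (join_r i).
have eE i : e i = comp (nt_map eta (fob x i)) (fmor F (fmor x (arrow0 i))).
  by rewrite /e /prism_leg join_caseE.
have ea i : src (e i) = fob F (fob x (ord0 : 'I_n.+1)) by exact: src_prism_leg.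
transitivity (cone Gd ea).
  by apply: functor_eq.
symmetry; apply: cone_unique => [i|f]; rewrite !eE.
  by rewrite (tgt_comp (prism_leg_composable x i)) nt_tgtE.
have nat := nt_natural eta (fmor x f); rewrite fsrc ftgt in nat.
rewrite compA/= ?prism_leg_composable//; last by rewrite nt_tgtE !fsrc.
rewrite -nat -compA ?nt_srcE ?ftgt ?fsrc//.
by rewrite -simplex_arrow0 fcomp// fsrc ftgt.
Qed.

(** Compatibility with a simplicial operator theta.  The two cones have the apexes
    F x_0 and F x_(theta 0); their legs differ by the morphism k between these, which
    cancels in every edge. *)
Lemma prism_map m n (theta : ordmap m n) (x : simplex C n) :
  functor_comp (prism x) (ord_functor (join_map theta)) =
  prism (functor_comp x (ord_functor theta)).
Proof.
(* The leg of [prism x] at the image of v is the leg at v of the prism of the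
   restricted simplex, precomposed with [k]. *)
pose k := fmor F (fmor x (arrow0 (theta ord0))).
pose e' := prism_leg (functor_comp x (ord_functor theta)).
have srce' v : src (e' v) = tgt k by rewrite src_prism_leg !ftgt.
have step (i : 'I_m.+1) : fmor x (arrow0 (theta i)) =
    comp (fmor x (fmor (ord_functor theta) (arrow0 i))) (fmor x (arrow0 (theta ord0))).
  exact: esym (simplex_arrow0 x (fmor (ord_functor theta) (arrow0 i))).
have composable (i : 'I_m.+1) : src (fmor x (fmor (ord_functor theta) (arrow0 i))) =
    tgt (fmor x (arrow0 (theta ord0))) by rewrite fsrc ftgt.
have e'k v : prism_leg x (join_map theta v) = comp (e' v) k.
  elim/join_caseP: v => i; rewrite /e' /prism_leg /= /join_map_fun !join_caseE step.
    by rewrite fcomp.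
  rewrite fcomp// compA//; first by rewrite nt_srcE !ftgt.
  by rewrite !fsrc !ftgt.
have ea v : src (e' v) = fob F (fob x (theta ord0)) by exact: src_prism_leg.
apply: cone_unique => [v|f].
  by rewrite /= e'k tgt_comp.
have := cone_mor_comp Gd (src_prism_leg x) (fmor (ord_functor (join_map theta)) f).
rewrite /= !e'k => E.
have c1 : src (cone_mor Gd (prism_leg x) (fmor (ord_functor (join_map theta)) f))
    = tgt (e' (val f).1).
  by rewrite (src_cone_mor Gd (src_prism_leg x)) /= e'k tgt_comp.
apply: (comp_cancelr Gd (k := k)) => //; first by rewrite src_comp.
by rewrite -compA.
Qed.

Lemma prism_leg_continuous n v : continuous (fun x : simplex C n => prism_leg x v).
Proof.
have cF f : continuous (fun x : simplex C n => fmor F (fmor x f)).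
  exact: (cts_comp (@simplex_mor_continuous _ _ f) (@fmor_continuous _ _ F)).
elim/join_caseP: v => i.
- under [X in continuous X]eq_fun do rewrite /prism_leg join_caseE.
  exact: cF.
- under [X in continuous X]eq_fun do rewrite /prism_leg join_caseE.
  apply: comp_continuous2 => [x||]; [exact: prism_leg_composable| |exact: cF].
  exact: (cts_comp (@simplex_ob_continuous _ _ i) (@nt_continuous _ _ eta)).
Qed.

Lemma prism_continuous n : continuous (@prism n).
Proof.
apply: simplex_continuous => [v|f].
  exact: (cts_comp (@prism_leg_continuous n v) (@tgt_continuous D)).
apply: comp_continuous2 => [x||].
- exact: (cone_composable Gd (src_prism_leg x)).
- exact: prism_leg_continuous.
- exact: (cts_comp (@prism_leg_continuous n _) (@ginv_continuous _ Gd)).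
Qed.

Variable R : realType.

Definition prism_cell (p : cells R (nerve C) * R) : B R D :=
  nerve_point (prism (tagged p.1).1) (join_weight (tagged p.1).2 p.2).

Lemma prism_cell_glue s : respects_glue (fun c => prism_cell (c, s)).
Proof.
move=> m n theta x t; rewrite /prism_cell /=.
by rewrite -join_weight_map -nerve_point_glue prism_map.
Qed.

Lemma prism_cell_continuous : continuous prism_cell.
Proof.
apply: continuous_sigT_prod => n.
pose T := set_type (@std_simplex R n).
apply: (@cts_comp _ _ _ (fun p : (simplex C n * T) * R =>
  (prism p.1.1, join_weight p.1.2 p.2)) (fun p => nerve_point p.1 p.2));
  last exact: nerve_point_continuous.
apply: continuous_pair.
  exact: (cts_comp (cts_comp (@cts_fst _ _) (@cts_fst _ _)) (@prism_continuous n)).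
apply: (@cts_comp _ _ _ (fun p : (simplex C n * T) * R => (p.1.2, p.2))
  (fun p => join_weight p.1 p.2)); last exact: join_weight_continuous.
apply: continuous_pair; last exact: cts_snd.
exact: (cts_comp (@cts_fst _ _) (@cts_snd _ _)).
Qed.

(** At time 0 all the weight is on the vertices F x_i, and at time 1 on the F' x_i;
    the gluing identifies the point with one of F x, respectively F' x. *)
Lemma nattrans_homotopic : homotopic R (@Bmap R C D F) (@Bmap R C D F').
Proof.
exists (fun p => realization_lift (fun c => prism_cell (c, p.2)) p.1); split.
- apply: continuous_subspaceT.
  exact: (realization_homotopy_continuous prism_cell_glue prism_cell_continuous).
- apply: B_ext => n x t; rewrite (realization_liftE (prism_cell_glue _)) BmapE.
  by rewrite /prism_cell /= join_weight0 -nerve_point_glue prism_l.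
- apply: B_ext => n x t; rewrite (realization_liftE (prism_cell_glue _)) BmapE.
  by rewrite /prism_cell /= join_weight1 -nerve_point_glue prism_r.
Qed.

End Prism.

Lemma cat_equivalent_homotopy_equivalent (R : realType) (C D : topCat)
    (GC : topGroupoid C) (GD : topGroupoid D) :
  cat_equivalent C D -> homotopy_equivalent R (B R C) (B R D).
Proof.
move=> [F [K [[a [_ [[a1 a2 _ _] _]]] [b [_ [[b1 b2 _ _] _]]]]]].
exists (@Bmap R C D F), (@Bmap R D C K); split; try exact: Bmap_continuous.
- have := nattrans_homotopic GC a R; rewrite a1 a2.
  by rewrite (funext (@Bmap_comp R _ _ _ K F)) (funext (@Bmap_id R C)).
- have := nattrans_homotopic GD b R; rewrite b1 b2.
  by rewrite (funext (@Bmap_comp R _ _ _ F K)) (funext (@Bmap_id R D)).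
Qed.

(** * The classifying space of a disjoint union *)

(** The projection onto one summand, sending all the others to a base point.  It
    allows the component of a simplex in its summand to be described by a functor
    defined on the whole union, so that no casts are needed. *)
Section SigmaProjection.
Variables (I : choiceType) (X : I -> Type) (i : I) (y0 : X i).

Definition sigT_proj (x : {j & X j}) : X i := tagged_as (existT X i y0) x.

Lemma sigT_projE y : sigT_proj (existT X i y) = y.
Proof. exact: (@tagged_asE _ _ (existT X i y0)). Qed.

Lemma sigT_proj_ne x : tag x != i -> sigT_proj x = y0.
Proof.
move=> ne; rewrite /sigT_proj /tagged_as; case: eqP => //= e.
by rewrite -e eqxx in ne.
Qed.

Lemma sigT_projK x : tag x = i -> existT X i (sigT_proj x) = x.
Proof. by case: x => j y /= e; case: _ / (esym e) y => y; rewrite sigT_projE. Qed.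

Lemma sigT_tagP (P : {j & X j} -> Prop) :
  (forall y, P (existT X i y)) -> (forall x, tag x != i -> P x) -> forall x, P x.
Proof.
move=> Pi Pn x; have [e|] := eqVneq (tag x) i; last exact: Pn.
by rewrite -(sigT_projK e); exact: Pi.
Qed.
End SigmaProjection.

Lemma sigT_proj_continuous (I : choiceType) (X : I -> topologicalType) i (y0 : X i) :
  continuous (sigT_proj y0 : {j & X j} -> X i).
Proof.
apply: sigT_discrete_continuous => j; have [->|ne] := eqVneq j i.
  under [X in continuous X]eq_fun do rewrite sigT_projE.
  by move=> y; exact: cvg_id.
under [X in continuous X]eq_fun do rewrite sigT_proj_ne//.
exact: cst_continuous.
Qed.

Section SumFunctors.
Variables (I : choiceType) (C : I -> topCat) (o : forall i, ob (C i)).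
Local Notation S := (sum_cat C).

Program Definition sum_inc i : functor (C i) S := {|
  fob := existT (fun i => ob (C i)) i : ob (C i) -> ob S;
  fmor := existT (fun i => mor (C i)) i : mor (C i) -> mor S
|}.
Next Obligation. by []. Qed.
Next Obligation. by []. Qed.
Next Obligation. by []. Qed.
Next Obligation. by move=> i g f _; rewrite /= tagged_asE. Qed.
Next Obligation. by move=> i; exact: existT_continuous. Qed.
Next Obligation. by move=> i; exact: existT_continuous. Qed.

Program Definition sum_ret i : functor S (C i) := {|
  fob := sigT_proj (o i) : ob S -> ob (C i);
  fmor := sigT_proj (idm (o i)) : mor S -> mor (C i)
|}.
Next Obligation.
move=> i; apply: (sigT_tagP (i := i) (idm (o i))) => [f|f ne].
  by rewrite /= !sigT_projE.
by rewrite !sigT_proj_ne// src_idm.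
Qed.
Next Obligation.
move=> i; apply: (sigT_tagP (i := i) (idm (o i))) => [f|f ne].
  by rewrite /= !sigT_projE.
by rewrite !sigT_proj_ne// tgt_idm.
Qed.
Next Obligation.
move=> i; apply: (sigT_tagP (i := i) (o i)) => [x|x ne].
  by rewrite /= !sigT_projE.
by rewrite !sigT_proj_ne.
Qed.
Next Obligation.
move=> i g; apply: (sigT_tagP (i := i) (idm (o i))) => [f|f ne] e.
  have tg : tag g = i by exact: (congr1 (@projT1 _ _) e).
  rewrite -(sigT_projK (idm (o i)) tg) /= !sigT_projE.
  by rewrite tagged_asE.
have tg : tag g = tag f by exact: (congr1 (@projT1 _ _) e).
rewrite !sigT_proj_ne ?tg//.
by have := comp1m (idm (o i)); rewrite tgt_idm.
Qed.
Next Obligation. by move=> i; exact: sigT_proj_continuous. Qed.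
Next Obligation. by move=> i; exact: sigT_proj_continuous. Qed.

Lemma sum_retK i : functor_comp (sum_ret i) (sum_inc i) = functor_id (C i).
Proof. by apply: functor_eq => x /=; exact: sigT_projE. Qed.

(** Each vertex is joined to the first one by a morphism, which lies in one
    summand. *)
Lemma simplex_tag n (x : simplex S n) (v : 'I_n.+1) :
  tag (fob x v) = tag (fob x (ord0 : 'I_n.+1)).
Proof.
have es := congr1 (@projT1 _ _) (fsrc x (arrow0 v)).
have et := congr1 (@projT1 _ _) (ftgt x (arrow0 v)).
exact: etrans (esym et) es.
Qed.

Lemma simplex_tag_mor n (x : simplex S n) (f : ord_arrow n) :
  tag (fmor x f) = tag (fob x (ord0 : 'I_n.+1)).
Proof. by rewrite -(simplex_tag x (val f).1); exact: (congr1 (@projT1 _ _) (fsrc x f)). Qed.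

Lemma sum_inc_retK n (x : simplex S n) i : tag (fob x (ord0 : 'I_n.+1)) = i ->
  functor_comp (sum_inc i) (functor_comp (sum_ret i) x) = x.
Proof.
move=> xi; apply: functor_eq => v /=; apply: sigT_projK.
  by rewrite simplex_tag.
by rewrite simplex_tag_mor.
Qed.

Variable R : realType.

Definition cell_tag (c : cells R (nerve S)) : discrete_topology I :=
  tag (fob (tagged c).1 (ord0 : 'I_(tag c).+1)).

Lemma cell_tag_glue : respects_glue cell_tag.
Proof. by move=> m n theta x t; rewrite /cell_tag /=; exact: simplex_tag. Qed.

Definition B_tag : B R S -> discrete_topology I := realization_lift cell_tag.

Lemma B_tagE n (x : simplex S n) t :
  B_tag (nerve_point x t) = tag (fob x (ord0 : 'I_n.+1)).
Proof. exact: (realization_liftE cell_tag_glue). Qed.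

Lemma B_tag_continuous : continuous B_tag.
Proof.
apply: realization_lift_continuous; first exact: cell_tag_glue.
apply: sigT_discrete_continuous => n.
have ct := @sum_tag_continuous I (fun i => ob (C i)).
exact: (cts_comp (cts_comp (@cts_fst _ _)
  (@simplex_ob_continuous S n (ord0 : 'I_n.+1))) ct).
Qed.

Definition B_split (z : B R S) : {i & B R (C i)} :=
  existT (fun i => B R (C i)) (B_tag z) (Bmap (sum_ret (B_tag z)) z).

Definition B_merge (z : {i & B R (C i)}) : B R S :=
  Bmap (sum_inc (tag z)) (tagged z).

(** Near a point the summand is constant, and there the map is induced by a fixed
    functor [sum_ret i]. *)
Lemma B_split_continuous : continuous B_split.
Proof.
move=> z U; set i := B_tag z => nU.
have nt : \forall w \near z, B_tag w = i.
  apply: (@B_tag_continuous z [set i]).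
  by apply: open_nbhs_nbhs; split => //; exact: (@discrete_open (discrete_topology I)).
have nr : \forall w \near z, U (existT _ i (Bmap (sum_ret i) w)).
  exact: (cts_comp (@Bmap_continuous R _ _ (sum_ret i))
    (@existT_continuous _ (fun i => B R (C i)) i) nU).
by apply: filterS2 nt nr => w wi; rewrite /= /B_split wi.
Qed.

Lemma B_merge_continuous : continuous B_merge.
Proof.
apply: sigT_discrete_continuous => i.
exact: (@Bmap_continuous R _ _ (sum_inc i)).
Qed.

Lemma B_mergeK : cancel B_merge B_split.
Proof.
move=> [i z]; rewrite /B_merge /B_split /=.
have -> : B_tag (Bmap (sum_inc i) z) = i.
  by move: z; apply: B_ext => n x t; rewrite BmapE B_tagE.
by rewrite -[Bmap _ (Bmap _ z)](Bmap_comp (sum_ret i) (sum_inc i) z) sum_retK Bmap_id.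
Qed.

Lemma B_splitK : cancel B_split B_merge.
Proof.
apply: B_ext => n x t; rewrite /B_merge /B_split /= B_tagE.
by rewrite !BmapE (sum_inc_retK (x := x) erefl).
Qed.

Lemma homotopy_equivalent_B_sum (X : topologicalType) :
  homotopy_equivalent R X (B R S) -> homotopy_equivalent R X {i & B R (C i)}.
Proof.
move=> [f [g [cf cg [H [cH H0 H1]] [K [cK K0 K1]]]]].
exists (B_split \o f), (g \o B_merge); split.
- exact: (cts_comp cf B_split_continuous).
- exact: (cts_comp B_merge_continuous cg).
- exists H; split => // x; rewrite H0 /= B_splitK//.
- exists (fun p => B_split (K (B_merge p.1, p.2))); split => [|z|z].
  + apply: (cts_comp _ B_split_continuous).
    apply/subspace_continuousP => p Sp U nU.
    have /subspace_continuousP/(_ (B_merge p.1, p.2) Sp U nU) := cK.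
    have cm : continuous (fun p : {i & B R (C i)} * R => (B_merge p.1, p.2)).
      apply: continuous_pair; last exact: cts_snd.
      exact: (cts_comp (@cts_fst _ _) B_merge_continuous).
    exact: cm.
  + by rewrite K0.
  + by rewrite K1 /= B_mergeK.
Qed.

End SumFunctors.

Local Close Scope ring_scope.

(** * The fixed point category *)

Theorem theorem0p5 (R : realType) (G : discreteGroupType) (Pi : topGroupType)
    (A : groupAct G Pi) :
  (forall rep : H1 A -> crossedHom A, cancel rep (@crossed_class G Pi A) ->
     cat_equivalent (fixed_point_category A)
       (sum_cat (fun x : H1 A => group_cat (subgroup_type (Aut (rep x)))))) /\
  (closed [set 1%g : Pi] ->
   forall rep : conj_classes A -> complement A,
     cancel rep (@conj_class G Pi A) ->
     cat_equivalent (fixed_point_category A)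
       (sum_cat (fun c : conj_classes A =>
          group_cat (subgroup_type (capPi (normalizer (rep c)))))) /\
     homotopy_equivalent R (B R (fixed_point_category A))
       {c : conj_classes A &
          B R (group_cat (subgroup_type (capPi (normalizer (rep c)))))}).
Proof.
split; first exact: fixed_cat_H1.
move=> cl1 rep repK; have [r [r_inj r_surj rE]] := complement_crossedHoms cl1 repK.
pose claim (H : conj_classes A -> subgroup Pi) :=
  cat_equivalent (fixed_point_category A)
    (sum_cat (fun c => group_cat (subgroup_type (H c)))) /\
  homotopy_equivalent R (B R (fixed_point_category A))
    {c : conj_classes A & B R (group_cat (subgroup_type (H c)))}.
suff : claim (fun c => Aut (r c)) by rewrite -rE.
have equiv := fixed_cat_sum r_inj r_surj; split=> //.
apply: (@homotopy_equivalent_B_sum _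
  (fun c => group_cat (subgroup_type (Aut (r c)))) (fun=> tt) R).
exact: (cat_equivalent_homotopy_equivalent R
  (model_groupoid (fixed_model A)) (model_groupoid (sum_model r_inj)) equiv).
Qed.
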